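(* Let $X$ be an infinite-dimensional complex Banach space, $T\in L(X)$, $\lambda_0\in\mathbb C$, and suppose that $\lambda_0-T$ admits a generalized Kato-meromorphic decomposition. Then the following statements are equivalent: (i) $T'$ has the SVEP at $\lambda_0$; (ii) $\lambda_0$ is not an interior point of $\sigma_{su}(T)$; (iii) $\sigma_{B\mathcal B_-}(T)$ does not cluster at $\lambda_0$ (that is, $\lambda_0$ is not an accumulation point of $\sigma_{B\mathcal B_-}(T)$).
   Context: $L(X)$ is the algebra of bounded linear operators on $X$; $T'$ is the dual (adjoint) operator on $X'$; $N(T)$, $R(T)$ are kernel and range; $\sigma_{su}(T)=\{\lambda\in\mathbb C:T-\lambda I\text{ is not surjective}\}$. $(M,N)\in Red(T)$ means that $M,N$ are closed $T$-invariant subspaces with $X=M\oplus N$; $T_M$, $T_N$ are the restrictions of $T$ viewed as operators on $M$, $N$. $T$ is Kato if $R(T)$ is closed and $N(T)\subset R(T^n)$ for every $n\in\mathbb N$. An operator is meromorphic if every non-zero point of its spectrum is a pole of its resolvent. An operator $T$ admits a generalized Kato-meromorphic decomposition if there is $(M,N)\in Red(T)$ with $T_M$ Kato and $T_N$ meromorphic. $T$ is lower semi-Browder if it is lower semi-Fredholm (range of finite codimension) with finite descent. $T$ is lower semi-B-Browder if there is an integer $n\ge0$ such that $R(T^n)$ is closed and the restriction of $T$ to $R(T^n)$, viewed as a map $R(T^n)\to R(T^n)$, is lower semi-Browder; it is known that this is equivalent to right Drazin invertibility: the descent $\delta(T)$ is finite and $R(T^{\delta(T)})$ is closed. $\sigma_{B\mathcal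 B_-}(T)=\{\lambda\in\mathbb C:T-\lambda I\text{ is not lower semi-B-Browder}\}$. An operator $S$ on a Banach space $Y$ has the SVEP (single-valued extension property) at $\lambda_0$ if for every open disc $\mathcal D_{\lambda_0}$ centered at $\lambda_0$ the only analytic function $f:\mathcal D_{\lambda_0}\to Y$ satisfying $(S-\lambda)f(\lambda)=0$ for all $\lambda\in\mathcal D_{\lambda_0}$ is $f\equiv 0$. *)

(* Defs.v *)
From HB Require Import structures.
From mathcomp Require Import all_boot all_order all_algebra.
From mathcomp Require Import complex.
From mathcomp Require Import all_classical all_reals topology normedtype sequences.

Set Implicit Arguments.
Unset Strict Implicit.
Unset Printing Implicit Defensive.

Import Order.TTheory GRing.Theory Num.Theory.
Import numFieldNormedType.Exports.

Local Open Scope classical_set_scope.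
Local Open Scope ring_scope.
Local Open Scope complex_scope.

(* The scalar field is [R[i]] with [R : realType].  The regular module [R[i]^o]
   is the same type, with its norm topology; it is used where a topology on the
   complex plane is needed. *)

Section BoundedOperators.
Variable R : realType.
Implicit Types X Y Z : normedModType R[i].

Definition bounded_linear X Y : {pred X -> Y} := fun f =>
  `[< linear f /\ exists M : R[i], forall x, `|f x| <= M * `|x| >].
Arguments bounded_linear : clear implicits.

Lemma bounded_linearP X Y (f : X -> Y) :
  reflect (linear f /\ exists M : R[i], forall x, `|f x| <= M * `|x|)
          (f \in bounded_linear X Y).
Proof. exact: asboolP. Qed.

Lemma bounded_linear_submod_closed X Y : submod_closed (bounded_linear X Y).
Proof.
split=> [|a f g /bounded_linearP[lf [M hM]] /bounded_linearP[lg [N hN]]].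
  apply/bounded_linearP; split; first by move=> a x y; rewrite scaler0 addr0.
  by exists 0 => x; rewrite normr0 mul0r.
apply/bounded_linearP; split.
  move=> b x y; rewrite !fctE lf lg !scalerDr !scalerA [a * b]mulrC -!addrA.
  by congr (_ + _); rewrite addrCA.
exists (`|a| * M + N) => x; rewrite !fctE.
by rewrite (le_trans (ler_normD _ _))// normrZ mulrDl -mulrA lerD// ler_wpM2l.
Qed.

HB.instance Definition _ X Y := GRing.isSubmodClosed.Build R[i] (X -> Y)
  (bounded_linear X Y) (@bounded_linear_submod_closed X Y).

Record bounded_op X Y := BoundedOp {
  bop_fun :> X -> Y;
  _ : bop_fun \in bounded_linear X Y }.

HB.instance Definition _ X Y := [isSub for @bop_fun X Y].
HB.instance Definition _ X Y := [Choice of bounded_op X Y by <:].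
HB.instance Definition _ X Y := [SubChoice_isSubLmodule of bounded_op X Y by <:].

Lemma bop_linear X Y (f : bounded_op X Y) : linear f.
Proof. by have /bounded_linearP[] := valP f. Qed.

HB.instance Definition _ X Y (f : bounded_op X Y) :=
  GRing.isLinear.Build R[i] X Y _ f (bop_linear f).

Lemma bop_bounded X Y (f : bounded_op X Y) :
  exists M : R[i], forall x, `|f x| <= M * `|x|.
Proof. by have /bounded_linearP[] := valP f. Qed.

(* The norm of a normed module over [R[i]] is valued in [R[i]], where suprema
   are not available; the supremum is therefore taken over real parts. *)
Definition opnorm X Y (f : bounded_op X Y) : R[i] :=
  (sup [set complex.Re `|f x| | x in [set x : X | `|x| <= 1]])%:C.


Lemma normC_Re (z : R[i]) : (complex.Re `|z|)%:C = `|z|.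
Proof. by rewrite RRe_real// normr_real. Qed.

Lemma norm_Re X (x : X) : (complex.Re `|x|)%:C = `|x|.
Proof. by rewrite RRe_real// normr_real. Qed.

Lemma opnorm_has_sup X Y (f : bounded_op X Y) :
  has_sup [set complex.Re `|f x| | x in [set x : X | `|x| <= 1]].
Proof.
split; first by exists (complex.Re `|f 0|), 0 => //=; rewrite normr0.
have [M hM] := bop_bounded f.
exists (complex.Re `|M|) => _ [x /= x1 <-].
rewrite -lecR norm_Re normC_Re (le_trans (hM x))//.
have M0 : 0 <= M * `|x| by rewrite (le_trans _ (hM x)).
by rewrite -[leLHS]ger0_norm// normrM normr_id ler_piMr.
Qed.

Lemma opnorm_ge0 X Y (f : bounded_op X Y) : 0 <= opnorm f.
Proof.
rewrite -[0]/(0%:C) lecR (@le_trans _ _ (complex.Re `|f 0|))//.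
  by rewrite -lecR norm_Re; exact: normr_ge0.
by apply: (ub_le_sup (opnorm_has_sup f).2); exists 0 => //=; rewrite normr0.
Qed.

Lemma opnorm_ub X Y (f : bounded_op X Y) x : `|f x| <= opnorm f * `|x|.
Proof.
have [->|x0] := eqVneq x 0; first by rewrite raddf0 !normr0 mulr0.
have nx0 : 0 < `|x| by rewrite normr_gt0.
have : `|f (`|x|^-1 *: x)| <= opnorm f.
  rewrite -norm_Re lecR; apply: (ub_le_sup (opnorm_has_sup f).2).
  exists (`|x|^-1 *: x) => //=.
  by rewrite normrZ normrV ?unitfE ?gt_eqF// normr_id mulVf// gt_eqF.
by rewrite linearZ/= normrZ normfV normr_id mulrC ler_pdivrMr.
Qed.

Lemma opnorm_le X Y (f : bounded_op X Y) (M : R[i]) : 0 <= M ->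
  (forall x, `|f x| <= M * `|x|) -> opnorm f <= M.
Proof.
move=> M0 hM; rewrite -[M]ger0_norm// -normC_Re lecR.
apply: ge_sup; first exact: (opnorm_has_sup f).1.
move=> _ [x /= x1 <-]; rewrite -lecR norm_Re normC_Re ger0_norm//.
by rewrite (le_trans (hM x))// ler_piMr.
Qed.

Lemma bop_ext X Y (f g : bounded_op X Y) : (forall x, f x = g x) -> f = g.
Proof. by move=> fg; apply/val_inj/funext. Qed.

Lemma bopD X Y (f g : bounded_op X Y) x : (f + g) x = f x + g x.
Proof. by []. Qed.

Lemma bopZ X Y a (f : bounded_op X Y) x : (a *: f) x = a *: f x.
Proof. by []. Qed.

Lemma opnormD X Y (f g : bounded_op X Y) :
  opnorm (f + g) <= opnorm f + opnorm g.
Proof.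
apply: opnorm_le => [|x]; first by rewrite addr_ge0 ?opnorm_ge0.
by rewrite bopD (le_trans (ler_normD _ _))// mulrDl lerD// opnorm_ub.
Qed.

Lemma opnormZ X Y (a : R[i]) (f : bounded_op X Y) :
  opnorm (a *: f) = `|a| * opnorm f.
Proof.
have hle b g : opnorm (b *: g : bounded_op X Y) <= `|b| * opnorm g.
  apply: opnorm_le => [|x]; first by rewrite mulr_ge0 ?opnorm_ge0.
  by rewrite bopZ normrZ -mulrA ler_wpM2l ?opnorm_ub.
have [->|a0] := eqVneq a 0.
  rewrite normr0 mul0r; apply/eqP; rewrite eq_le opnorm_ge0 andbT.
  by rewrite (le_trans (hle _ _))// normr0 mul0r.
apply/eqP; rewrite eq_le hle/= -ler_pdivlMl ?normr_gt0//.
by rewrite -{1}[f](scalerK a0) (le_trans (hle _ _))// normfV.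
Qed.

Lemma opnorm_eq0 X Y (f : bounded_op X Y) : opnorm f = 0 -> f = 0.
Proof.
move=> f0; apply: bop_ext => x; apply/eqP; rewrite -normr_le0.
by rewrite (le_trans (opnorm_ub f x))// f0 mul0r.
Qed.

HB.instance Definition _ X Y := Lmodule_isNormed.Build R[i] (bounded_op X Y)
  (@opnormD X Y) (@opnormZ X Y) (@opnorm_eq0 X Y).

Lemma bop_id_subproof X : idfun \in bounded_linear X X.
Proof.
by apply/bounded_linearP; split => //; exists 1 => x; rewrite mul1r.
Qed.

Definition bop_id X : bounded_op X X := BoundedOp (bop_id_subproof X).

Lemma bop_comp_subproof X Y Z (g : bounded_op Y Z) (f : bounded_op X Y) :
  g \o f \in bounded_linear X Z.
Proof.
apply/bounded_linearP; split; first by move=> a x y; rewrite /= !linearP.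
exists (opnorm g * opnorm f) => x /=.
by rewrite (le_trans (opnorm_ub g _))// -mulrA ler_wpM2l ?opnorm_ge0 ?opnorm_ub.
Qed.

Definition bop_comp X Y Z (g : bounded_op Y Z) (f : bounded_op X Y) :
  bounded_op X Z := BoundedOp (bop_comp_subproof g f).

Definition dual X := bounded_op X R[i]^o.

Lemma adjoint_subproof X Y (T : bounded_op X Y) :
  (fun phi : dual Y => bop_comp phi T) \in bounded_linear (dual Y) (dual X).
Proof.
apply/bounded_linearP; split; first by move=> a f g; apply: bop_ext.
exists (opnorm T) => phi; apply: opnorm_le => [|x].
  by rewrite mulr_ge0 ?opnorm_ge0.
rewrite (le_trans (opnorm_ub phi _))// [opnorm T * _]mulrC -mulrA.
by rewrite ler_wpM2l ?opnorm_ge0 ?opnorm_ub.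
Qed.

Definition adjoint X Y (T : bounded_op X Y) : bounded_op (dual Y) (dual X) :=
  BoundedOp (adjoint_subproof T).

End BoundedOperators.

Arguments bounded_linear {R} X Y _.

Section Subspaces.
Variables (R : realType) (X : normedModType R[i]).
Implicit Types T : bounded_op X X.

Record subspace_of (M : submodClosed X) := SubspaceOf {
  subspace_val :> X;
  _ : subspace_val \in M }.

HB.instance Definition _ M := [isSub for @subspace_val M].
HB.instance Definition _ M := [Choice of subspace_of M by <:].
HB.instance Definition _ M := [SubChoice_isSubLmodule of subspace_of M by <:].

Definition subspace_norm M (x : subspace_of M) : R[i] := `|val x|.

Lemma subspace_normD M (x y : subspace_of M) :
  subspace_norm (x + y) <= subspace_norm x + subspace_norm y.
Proof. exact: ler_normD. Qed.

Lemma subspace_normZ M (a : R[i]) (x : subspace_of M) :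
  subspace_norm (a *: x) = `|a| * subspace_norm x.
Proof. exact: normrZ. Qed.

Lemma subspace_norm_eq0 M (x : subspace_of M) : subspace_norm x = 0 -> x = 0.
Proof. by move=> /normr0_eq0 x0; apply: val_inj. Qed.

HB.instance Definition _ M := Lmodule_isNormed.Build R[i] (subspace_of M)
  (@subspace_normD M) (@subspace_normZ M) (@subspace_norm_eq0 M).

Definition invariant (T : bounded_op X X) (M : submodClosed X) :=
  forall x, x \in M -> T x \in M.

Definition restr_fun T M (TM : invariant T M) (x : subspace_of M) :
  subspace_of M := SubspaceOf (TM _ (valP x)).

Lemma restr_subproof T M (TM : invariant T M) :
  restr_fun TM \in bounded_linear (subspace_of M) (subspace_of M).
Proof.
apply/bounded_linearP; split.
  by move=> a x y; apply: val_inj; rewrite /= linearP.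
by exists (opnorm T) => x; apply: opnorm_ub.
Qed.

Definition restr T M (TM : invariant T M) :
  bounded_op (subspace_of M) (subspace_of M) := BoundedOp (restr_subproof TM).

Definition direct_sum (M N : submodClosed X) :=
  (forall x, exists2 m, m \in M & exists2 n, n \in N & x = m + n) /\
  (forall x, x \in M -> x \in N -> x = 0).

Definition range_pow (T : bounded_op X X) (n : nat) : {pred X} :=
  fun y => `[< range (iter n T) y >].

Lemma range_powP (T : bounded_op X X) n y :
  reflect (exists x, iter n T x = y) (y \in range_pow T n).
Proof.
by apply: (iffP (asboolP _)) => [[x _ <-]|[x <-]]; exists x.
Qed.

Lemma range_pow_submod_closed (T : bounded_op X X) n : submod_closed (range_pow T n).
Proof.
have lin a x y : iter n T (a *: x + y) = a *: iter n T x + iter n T y.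
  by elim: n => //= n ->; rewrite linearP.
have it0 : iter n T 0 = 0 by elim: n {lin} => //= n ->; rewrite raddf0.
split=> [|a _ _ /range_powP[x <-] /range_powP[y <-]]; apply/range_powP.
  by exists 0.
by exists (a *: x + y).
Qed.

HB.instance Definition _ (T : bounded_op X X) n := GRing.isSubmodClosed.Build R[i] X
  (range_pow T n) (range_pow_submod_closed T n).

Lemma range_pow_invariant (T : bounded_op X X) n : invariant T (range_pow T n).
Proof.
by move=> _ /range_powP[x <-]; apply/range_powP; exists (T x); rewrite -iterSr.
Qed.

Definition restr_range_pow (T : bounded_op X X) (n : nat) :
  bounded_op (subspace_of (range_pow T n)) (subspace_of (range_pow T n)) :=
  restr (@range_pow_invariant T n).

End Subspaces.

Section Analytic.
Variables (R : realType) (E : normedModType R[i]).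
Implicit Types (f g : R[i]^o -> E) (mu : R[i]^o).

(* Local expansion in power series converging in norm; for an open [U] the
   radius can always be shrunk so that the disc lies inside [U]. *)
Definition analytic_on f (U : set R[i]^o) :=
  forall z, U z -> exists (a : nat -> E) (r : R[i]), 0 < r /\
    forall w : R[i]^o, ball z r w ->
      series (fun n => (w - z) ^+ n *: a n) @ \oo --> f w.

Definition pole f mu := exists (n : nat) (r : R[i]) (g : R[i]^o -> E),
  [/\ (0 < n)%N, 0 < r, analytic_on g (ball mu r), g mu != 0 &
      forall z, ball mu r z -> z != mu -> f z = (z - mu) ^- n *: g z].

End Analytic.

Section OperatorClasses.
Variables (R : realType) (X : normedModType R[i]).
Implicit Types (T S : bounded_op X X) (z mu : R[i]^o).

Definition svep_at S (z0 : R[i]^o) :=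
  forall e : R[i], 0 < e -> forall f : R[i]^o -> X,
    analytic_on f (ball z0 e) ->
    (forall z, ball z0 e z -> (S - z *: bop_id X) (f z) = 0) ->
    forall z, ball z0 e z -> f z = 0.

Definition is_inverse T S :=
  bop_comp S T = bop_id X /\ bop_comp T S = bop_id X.

Definition spectrum T : set R[i]^o :=
  [set z | ~ exists S, is_inverse (T - z *: bop_id X) S].

(* Equal to [(T - z)^-1] off the spectrum and to [0] on it. *)
Definition resolvent T z : bounded_op X X :=
  xget 0 [set S | is_inverse (T - z *: bop_id X) S].

Definition surjective_spectrum T : set R[i]^o :=
  [set z | ~ forall y, exists x, (T - z *: bop_id X) x = y].

(* Isolatedness must be required separately, since [resolvent] is total. *)
Definition meromorphic T :=
  forall mu, spectrum T mu -> mu != 0 ->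
    ~ limit_point (spectrum T) mu /\ pole (resolvent T) mu.

Definition kato T :=
  closed (range T) /\ forall n, [set x | T x = 0] `<=` range (iter n T).

Definition finite_codim (A : set X) :=
  exists (n : nat) (e : 'I_n -> X), forall x, exists a : 'I_n -> R[i],
    A (x - \sum_(i < n) a i *: e i).

Definition infinite_dimensional := ~ finite_codim [set 0].

Definition finite_descent T :=
  exists p, range (iter p T) = range (iter p.+1 T).

(* On a Banach space a bounded operator with range of finite codimension has
   closed range, so closedness is not part of the definition. *)
Definition lower_semi_Fredholm T := finite_codim (range T).

Definition lower_semi_Browder T := lower_semi_Fredholm T /\ finite_descent T.

End OperatorClasses.

Section Decompositions.
Variables (R : realType) (X : normedModType R[i]).
Implicit Types T : bounded_op X X.

Definition generalized_Kato_meromorphic T :=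
  exists (M N : submodClosed X) (TM : invariant T M) (TN : invariant T N),
    [/\ closed [set x | x \in M], closed [set x | x \in N], direct_sum M N,
        kato (restr TM) & meromorphic (restr TN)].

Definition lower_semi_B_Browder T :=
  exists n, closed (range (iter n T)) /\
            lower_semi_Browder (restr_range_pow T n).

Definition lower_semi_B_Browder_spectrum T : set R[i]^o :=
  [set z | ~ lower_semi_B_Browder (T - z *: bop_id X)].

End Decompositions.

Arguments infinite_dimensional {R} X.

(* Main.v *)
(* Let [S = l0 - T], with [S|M] Kato and [S|N] meromorphic, so that
   [T - (l0 - w) = -(S - w)].

   If [S M = M], then [S - w] maps [M] onto [M] for all small [w] (open mapping
   theorem), and it maps [N] onto [N] unless [w] is one of the poles of the
   resolvent of [S|N], which are isolated. Points where [T - z] is onto thus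
   accumulate at [l0], which gives (ii), and (i) by the identity theorem; at a pole
   of order [n] the range of [(S|N - w)^n] is closed and equals that of
   [(S|N - w)^(n+1)], which gives (iii).

   If [S M <> M], the Kato property and the Hahn-Banach theorem provide an analytic
   family [f w <> 0] of functionals with [f w \o S = w * f w] for all small [w]. It
   contradicts the SVEP of the adjoint, it shows that no [T - z] with [z] near [l0]
   is onto, and that none has finite descent. So (i), (ii) and (iii) all fail. *)

Require Import Defs.
From mathcomp Require Import all_boot all_order all_algebra.
From mathcomp Require Import complex.
From mathcomp Require Import all_classical all_reals topology normedtype sequences.
From mathcomp Require Import lra ring.

Import Order.TTheory GRing.Theory Num.Theory.
Import numFieldNormedType.Exports.

Local Open Scope classical_set_scope.
Local Open Scope ring_scope.
Local Open Scope complex_scope.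

Set Implicit Arguments.
Unset Strict Implicit.
Unset Printing Implicit Defensive.

(** The summand [N] never decides between the two cases: 0 may be a limit of poles of the resolvent
    of [S|N], but each nonzero pole is isolated, so regular points of [S|N] still come arbitrarily
    close to 0. For the descent in the second case a single eigenfunctional is useless, since [f w]
    vanishes on the range of every positive power of [w - S]. It is the neighbouring values
    [f (w + t)] that separate consecutive powers, by a factor [-t]. The family must therefore be
    analytic at every point near 0, which forces a re-expansion of its power series away from the
    centre and geometric bounds on its coefficients. The ratio of these bounds is a product of two
    constants, one for the projection onto [M] along [N], one for solving [S x = y] in [M]. Both
    come from one open mapping theorem, stated for closed linear relations between Banach spaces so
    that [M] and [N] can be treated as subsets of [X]: the type of their points has a norm but no
    completeness structure. *)

Section RealNorm.
Variable R : realType.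

(* The norm is valued in the partially ordered [R[i]]; estimates are carried out
   in [R]. *)
Definition nrm (E : normedModType R[i]) (x : E) : R := complex.Re `|x|.

(** * Estimates and convergence in terms of the real-valued norm *)

Section Basics.
Variable E : normedModType R[i].
Implicit Types (x y l : E) (a b : R[i]^o) (u : nat -> E).

Lemma nrmE x : (nrm x)%:C = `|x|. Proof. exact: norm_Re. Qed.

Lemma nrm_le x (r : R) : (nrm x <= r) = (`|x| <= r%:C).
Proof. by rewrite -nrmE lecR. Qed.

Lemma nrm_lt x (r : R) : (nrm x < r) = (`|x| < r%:C).
Proof. by rewrite -nrmE ltcR. Qed.

Lemma nrm_ge0 x : 0 <= nrm x.
Proof. by rewrite -lecR nrmE normr_ge0. Qed.

Lemma nrm0 : nrm (0 : E) = 0. Proof. by rewrite /nrm normr0. Qed.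

Lemma nrm0_eq0 x : nrm x = 0 -> x = 0.
Proof. by move=> x0; apply/normr0_eq0; rewrite -nrmE x0. Qed.

Lemma nrm_gt0 x : x != 0 -> 0 < nrm x.
Proof.
move=> x0; rewrite lt_neqAle nrm_ge0 andbT; apply: contra_neq x0 => /esym.
exact: nrm0_eq0.
Qed.

Lemma nrmN x : nrm (- x) = nrm x. Proof. by rewrite /nrm normrN. Qed.

Lemma nrmBC x y : nrm (x - y) = nrm (y - x).
Proof. by rewrite -nrmN opprB. Qed.

Lemma nrmD x y : nrm (x + y) <= nrm x + nrm y.
Proof. by rewrite -lecR rmorphD/= !nrmE ler_normD. Qed.

Lemma nrmB x y : nrm (x - y) <= nrm x + nrm y.
Proof. by rewrite -(nrmN y) nrmD. Qed.

Lemma nrm_triangle x y z : nrm (x - z) <= nrm (x - y) + nrm (y - z).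
Proof. by rewrite (le_trans _ (nrmD _ _))// addrA subrK. Qed.

Lemma nrmZ a x : nrm (a *: x) = nrm a * nrm x.
Proof. by apply: complexI; rewrite rmorphM/= !nrmE normrZ. Qed.

Lemma nrm_sum (I : Type) (s : seq I) (P : pred I) (F : I -> E) :
  nrm (\sum_(i <- s | P i) F i) <= \sum_(i <- s | P i) nrm (F i).
Proof.
elim/big_ind2 : _ => [|x r y s' xr ys|//]; first by rewrite nrm0.
by rewrite (le_trans (nrmD _ _))// lerD.
Qed.

Lemma nrm_small_eq0 x : (forall e : R, 0 < e -> nrm x < e) -> x = 0.
Proof.
move=> h; apply: nrm0_eq0; apply/eqP; rewrite eq_le nrm_ge0 andbT.
by apply/ler_addgt0Pl => e e0; rewrite addr0 ltW// h.
Qed.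

Lemma complex_gt0 (e : R[i]) : 0 < e -> exists2 r : R, 0 < r & e = r%:C.
Proof.
move=> e0; exists (complex.Re e); last by rewrite RRe_real// gtr0_real.
by rewrite -ltcR RRe_real// gtr0_real.
Qed.

Lemma ball_nrm x (r : R) y : ball x r%:C y <-> nrm (y - x) < r.
Proof. by rewrite -ball_normE/= nrmBC nrm_lt. Qed.

Lemma nbhs_nrm x (A : set E) :
  nbhs x A <-> exists2 r : R, 0 < r & forall y, nrm (y - x) < r -> A y.
Proof.
split=> [/nbhs_ballP[e /= /complex_gt0[r r0 ->] rA]|[r r0 rA]].
  by exists r => // y /ball_nrm /rA.
apply/nbhs_ballP; exists r%:C; first by rewrite /= ltcR.
by move=> y /ball_nrm /rA.
Qed.

Lemma closed_nrm (A : set E) : closed A <->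
  forall x, (forall e : R, 0 < e -> exists2 y, A y & nrm (x - y) < e) -> A x.
Proof.
split=> [cA x xA|cA x xA].
  apply: cA => B /nbhs_nrm[r r0 rB]; have [y Ay yr] := xA _ r0.
  by exists y; split => //; apply: rB; rewrite nrmBC.
apply: cA => e e0; have [|y [Ay ye]] := xA [set y | nrm (y - x) < e].
  by apply/nbhs_nrm; exists e.
by exists y => //; rewrite nrmBC.
Qed.

Lemma cvg_nrm u l : u @ \oo --> l <->
  forall e : R, 0 < e -> exists N, forall n, (N <= n)%N -> nrm (l - u n) < e.
Proof.
split=> [ul e e0|ul].
  move/cvgrPdist_lt : ul => /(_ e%:C); rewrite ltcR => /(_ e0)[N _ hN].
  by exists N => n /hN /=; rewrite nrm_lt.
apply/cvgrPdist_lt => _ /complex_gt0[e e0 ->].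
by have [N hN] := ul _ e0; exists N => // n /hN; rewrite nrm_lt.
Qed.

Lemma cvg_nrm_unique u (l1 l2 : E) : u @ \oo --> l1 -> u @ \oo --> l2 -> l1 = l2.
Proof. exact: cvg_unique. Qed.

Lemma nrm_lim_le u l x (r : R) k : u @ \oo --> l ->
  (forall n, (k <= n)%N -> nrm (u n - x) <= r) -> nrm (l - x) <= r.
Proof.
move=> /cvg_nrm ul ur; apply/ler_addgt0Pl => e e0.
have [N hN] := ul _ e0.
apply: (le_trans (nrm_triangle _ (u (maxn N k)) _)).
by rewrite lerD ?ur ?leq_maxr// ltW// hN// leq_maxl.
Qed.

End Basics.

Section Scalars.
Implicit Types a b : R[i]^o.

Lemma nrmM a b : nrm (a * b : R[i]^o) = nrm a * nrm b.
Proof. exact: (nrmZ a b). Qed.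

Lemma nrm1 : nrm (1 : R[i]^o) = 1.
Proof. by rewrite /nrm normr1. Qed.

Lemma nrmX a n : nrm (a ^+ n : R[i]^o) = nrm a ^+ n.
Proof. by elim: n => [|n ih]; rewrite ?expr0 ?nrm1// !exprS nrmM ih. Qed.

Lemma nrmV a : nrm (a^-1 : R[i]^o) = (nrm a)^-1.
Proof.
have [->|a0] := eqVneq a 0; first by rewrite invr0 nrm0 invr0.
have na := nrm_gt0 a0.
apply: (mulfI (lt0r_neq0 na)); rewrite -nrmM mulfV ?nrm1// mulfV//.
exact: lt0r_neq0.
Qed.

Lemma nrm_real (r : R) : nrm (r%:C : R[i]^o) = `|r|.
Proof. by apply: complexI; rewrite nrmE normc_def /= expr0n addr0 sqrtr_sqr. Qed.

Lemma nrm_nat n : nrm (n%:R : R[i]^o) = n%:R.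
Proof. by rewrite -(rmorph_nat (real_complex R)) nrm_real ger0_norm. Qed.

Lemma Re_le_nrm a : `|complex.Re a| <= nrm a.
Proof.
case: a => x y; rewrite -lecR nrmE normc_def/= lecR -sqrtr_sqr.
by rewrite ler_sqrt ?addr_ge0 ?sqr_ge0// lerDl sqr_ge0.
Qed.

Lemma Im_le_nrm a : `|complex.Im a| <= nrm a.
Proof.
case: a => x y; rewrite -lecR nrmE normc_def/= lecR -sqrtr_sqr.
by rewrite ler_sqrt ?addr_ge0 ?sqr_ge0// lerDr sqr_ge0.
Qed.

Lemma nrm_le_ReIm a : nrm a <= `|complex.Re a| + `|complex.Im a|.
Proof.
rewrite -(nrm_real (complex.Re a)).
have -> : nrm a = nrm ((complex.Re a)%:C + 'i%C * (complex.Im a)%:C : R[i]^o).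
  by rewrite -complexE.
rewrite (le_trans (nrmD _ _))// lerD2l nrmM.
have -> : nrm ('i%C : R[i]^o) = 1.
  by apply: complexI; rewrite nrmE normc_def /= expr0n add0r expr1n sqrtr1.
by rewrite mul1r nrm_real.
Qed.

End Scalars.

(** * Geometric series and Cauchy sequences *)

Lemma expr_lt_eps (q e : R) : 0 <= q < 1 -> 0 < e ->
  exists N, forall n, (N <= n)%N -> q ^+ n < e.
Proof.
move=> /andP[q0 q1] e0; have /cvgrPdist_lt/(_ e e0) : q ^+ n @[n --> \oo] --> 0.
  by apply: cvg_expr; rewrite ger0_norm.
move=> [N _ hN]; exists N => n /hN /=; rewrite sub0r normrN ger0_norm//.
exact: exprn_ge0.
Qed.

Lemma geometric_bound (q : R) k n : 0 <= q < 1 ->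
  \sum_(k <= i < n) q ^+ i <= q ^+ k / (1 - q).
Proof.
move=> /andP[q0 q1]; have p0 : 0 < 1 - q by rewrite subr_gt0.
rewrite ler_pdivlMr//; have [kn|nk] := leqP k n; last first.
  by rewrite big_geq ?mul0r ?exprn_ge0// ltnW.
suff -> : (\sum_(k <= i < n) q ^+ i) * (1 - q) = q ^+ k - q ^+ n.
  by rewrite gerBl exprn_ge0.
elim: n kn => [|n ih]; first by rewrite leqn0 => /eqP ->; rewrite big_geq ?mul0r ?subrr.
rewrite leq_eqVlt => /orP[/eqP ->|kn]; first by rewrite big_geq ?mul0r ?subrr.
by rewrite big_nat_recr//= mulrDl ih// exprSr; ring.
Qed.

Lemma expr_scaled_lt_eps (K q e : R) : 0 <= q < 1 -> 0 < e ->
  exists N, forall n, (N <= n)%N -> K * q ^+ n < e.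
Proof.
move=> q01 e0; have K1 : 0 < `|K| + 1 by rewrite ltr_wpDl.
have [|N hN] := @expr_lt_eps q (e / (`|K| + 1)) q01; first exact: divr_gt0.
exists N => n /hN; rewrite ltr_pdivlMr// => h; apply: le_lt_trans h.
case/andP: q01 => q0 _.
by rewrite mulrC ler_wpM2l ?exprn_ge0// (le_trans (ler_norm _))// lerDl.
Qed.

Definition nrm_cauchy (E : normedModType R[i]) (u : nat -> E) :=
  forall e : R, 0 < e -> exists N, forall n, (N <= n)%N -> nrm (u n - u N) < e.

Lemma nrm_cauchy_cvg (E : completeNormedModType R[i]) (u : nat -> E) :
  nrm_cauchy u -> exists l : E, u @ \oo --> l.
Proof.
move=> uc; suff /cauchy_cvgP/cvg_ex[l ul] : cauchy (u @ \oo) by exists l.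
apply/cauchy_ballP => _ /complex_gt0[e e0 ->].
have [N hN] := uc (e / 2) (divr_gt0 e0 (ltr0n _ 2)).
exists ([set u n | n in [set n | (N <= n)%N]], [set u n | n in [set n | (N <= n)%N]]).
  by split; exists N => // n /= Nn; exists n.
move=> [_ _] [/= [n Nn <-] [m Nm <-]]; apply/ball_nrm.
apply: (le_lt_trans (nrm_triangle _ (u N) _)).
by rewrite (splitr e) ltrD ?hN// nrmBC hN.
Qed.

(** Real and imaginary parts are Cauchy in [R]. Completeness of the scalars is what later makes the
    dual space complete. *)
Lemma complex_cauchy_cvg (u : nat -> R[i]^o) :
  nrm_cauchy u -> exists l : R[i]^o, u @ \oo --> l.
Proof.
move=> uc.
have real_cvg (v : nat -> R) : (forall e : R, 0 < e ->
    exists N, forall n, (N <= n)%N -> `|v n - v N| < e) ->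
    exists l, forall e : R, 0 < e -> exists N, forall n, (N <= n)%N -> `|l - v n| < e.
  move=> vc; suff /cauchy_cvgP/cvg_ex[l vl] : cauchy (v @ \oo).
    exists l => e e0; move/cvgrPdist_lt : vl => /(_ e e0)[N _ hN].
    by exists N => n /hN.
  apply/cauchy_ballP => e e0; have [N hN] := vc (e / 2) (divr_gt0 e0 (ltr0n _ 2)).
  exists ([set v n | n in [set n | (N <= n)%N]], [set v n | n in [set n | (N <= n)%N]]).
    by split; exists N => // n /= Nn; exists n.
  move=> [_ _] [/= [n Nn <-] [m Nm <-]]; rewrite -ball_normE/=.
  rewrite (_ : v n - v m = (v n - v N) - (v m - v N)); last by ring.
  by rewrite (le_lt_trans (ler_normB _ _))// (splitr e) ltrD ?hN.
have [|x hx] := real_cvg (fun n => complex.Re (u n)).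
  move=> e e0; have [N hN] := uc _ e0; exists N => n /hN; apply: le_lt_trans.
  by rewrite -raddfB; exact: (Re_le_nrm (u n - u N)).
have [|y hy] := real_cvg (fun n => complex.Im (u n)).
  move=> e e0; have [N hN] := uc _ e0; exists N => n /hN; apply: le_lt_trans.
  by rewrite -raddfB; exact: (Im_le_nrm (u n - u N)).
exists (x +i* y); apply/cvg_nrm => e e0.
have e2 := divr_gt0 e0 (ltr0n _ 2).
have [N1 hN1] := hx _ e2; have [N2 hN2] := hy _ e2.
exists (maxn N1 N2) => n; rewrite geq_max => /andP[/hN1 h1 /hN2 h2].
rewrite (le_lt_trans (nrm_le_ReIm _))// (splitr e) ltrD//.
  by rewrite raddfB.
by rewrite raddfB.
Qed.

Lemma geometric_cauchy (E : normedModType R[i]) (u : nat -> E) (K q : R) :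
  0 <= q < 1 -> (forall n, nrm (u n) <= K * q ^+ n) ->
  forall k n, nrm (series u n - series u k) <= K / (1 - q) * q ^+ minn k n.
Proof.
move=> q01 uK.
have K0 : 0 <= K by rewrite (le_trans (nrm_ge0 (u 0%N)))// (le_trans (uK _))// mulr1.
have h k n : (k <= n)%N -> nrm (series u n - series u k) <= K / (1 - q) * q ^+ k.
  move=> kn; rewrite /series/= (big_cat_nat_idem _ (leq0n k) kn)/= ?addr0//.
  rewrite addrAC subrr add0r (le_trans (nrm_sum _ _ _))//.
  apply: (@le_trans _ _ (\sum_(k <= i < n) K * q ^+ i)); first exact: ler_sum.
  by rewrite -mulr_sumr -mulrA ler_wpM2l// mulrC geometric_bound.
move=> k n; have [kn|/ltnW nk] := leqP k n; first exact: h.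
by rewrite nrmBC h.
Qed.

Lemma geometric_nrm_cauchy (E : normedModType R[i]) (u : nat -> E) (K q : R) :
  0 <= q < 1 -> (forall n, nrm (u n) <= K * q ^+ n) -> nrm_cauchy (series u).
Proof.
move=> q01 uK e e0.
have [N hN] := expr_scaled_lt_eps (K / (1 - q)) q01 e0.
exists N => n Nn; apply: (le_lt_trans (geometric_cauchy q01 uK _ _)).
by rewrite (minn_idPl Nn) hN.
Qed.

Lemma geometric_tail (E : normedModType R[i]) (u : nat -> E) (K q : R) (l : E) :
  0 <= q < 1 -> (forall n, nrm (u n) <= K * q ^+ n) -> series u @ \oo --> l ->
  forall k, nrm (l - series u k) <= K / (1 - q) * q ^+ k.
Proof.
move=> q01 uK ul k; apply: (nrm_lim_le (k := k) ul) => n kn.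
by rewrite (le_trans (geometric_cauchy q01 uK _ _))// (minn_idPl kn).
Qed.

Section Bounded.
Variables E F : normedModType R[i].

Lemma bop_nrm_bound (f : bounded_op E F) (x : E) : nrm (f x) <= nrm f * nrm x.
Proof. by rewrite -lecR rmorphM/= !nrmE; exact: opnorm_ub. Qed.

Lemma bop_nrm_le (f : bounded_op E F) (M : R) : 0 <= M ->
  (forall x, nrm (f x) <= M * nrm x) -> nrm f <= M.
Proof.
move=> M0 fM; rewrite nrm_le; apply: opnorm_le => [|x]; first by rewrite lecR.
by rewrite -!nrmE -rmorphM/= lecR.
Qed.

Lemma bounded_op_exists (f : E -> F) (M : R) : linear f ->
  (forall x, nrm (f x) <= M * nrm x) -> exists g : bounded_op E F, g =1 f.
Proof.
move=> lf fM; suff fb : f \in bounded_linear E F by exists (BoundedOp fb).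
apply/bounded_linearP; split=> //; exists M%:C => x.
by rewrite -!nrmE -rmorphM/= lecR.
Qed.

Lemma bop_cvg (f : bounded_op E F) (u : nat -> E) (l : E) :
  u @ \oo --> l -> f \o u @ \oo --> f l.
Proof.
move=> /cvg_nrm ul; apply/cvg_nrm => e e0.
have c0 : 0 < nrm f + 1 by rewrite ltr_wpDl// nrm_ge0.
have [N hN] := ul _ (divr_gt0 e0 c0); exists N => n /hN.
rewrite ltr_pdivlMr// => h; apply: le_lt_trans h; rewrite /= -raddfB.
by rewrite (le_trans (bop_nrm_bound _ _))// mulrC ler_wpM2l ?nrm_ge0// lerDl.
Qed.

End Bounded.

End RealNorm.

(** * Open mapping theorem for closed linear relations *)

Section OpenMapping.
Variable R : realType.

(** Nested closed balls centred in [Y], the one chosen at stage [k + 1] missing [F k], would have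
    centres converging to a point of [Y] outside the union. The lemma is about a closed subset [Y]
    so that it applies to the closed range of a relation. *)
Lemma baire_closed_cover (X : completeNormedModType R[i]) (Y : set X)
    (F : nat -> set X) : closed Y -> Y 0 -> (forall k, closed (F k)) ->
    Y `<=` \bigcup_k F k ->
  exists k y0 (r : R), [/\ Y y0, 0 < r &
    forall y, Y y -> nrm (y - y0) < r -> F k y].
Proof.
move=> cY Y0 cF YF; apply: contrapT => nex.
have step (kp : nat * (X * R)) : exists p : X * R,
    Y kp.2.1 -> 0 < kp.2.2 ->
    [/\ Y p.1, 0 < p.2 <= kp.2.2 / 2, nrm (p.1 - kp.2.1) + p.2 <= kp.2.2 &
      forall y, nrm (y - p.1) <= p.2 -> ~ F kp.1 y].
  case: kp => k [x r] /=.
  have [Yx|nYx] := pselect (Y x); last by exists (x, r).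
  have [r0|nr0] := pselect (0 < r); last by exists (x, r).
  have r2 : 0 < r / 2 by rewrite divr_gt0.
  have [y [Yy yr Fy]] : exists y, [/\ Y y, nrm (y - x) < r / 2 & ~ F k y].
    apply: contrapT => ney; apply: nex; exists k, x, (r / 2); split => // y Yy yr.
    by apply: contrapT => Fy; apply: ney; exists y.
  have [e e0 he] : exists2 e : R, 0 < e & forall z, nrm (z - y) < e -> ~ F k z.
    apply: contrapT => nee; apply: Fy; apply: ((closed_nrm _).1 (cF k)) => e e0.
    apply: contrapT => nez; apply: nee; exists e => // z zy Fz.
    by apply: nez; exists z => //; rewrite nrmBC.
  (* [e / 2] keeps the closed ball inside the open one that misses [F k]; [r / 2] keeps it inside
     the previous ball and makes the radii tend to 0. *)
  exists (y, Num.min (e / 2) (r / 2)) => _ _; split => //=.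
  - by rewrite lt_min divr_gt0// r2/= ge_min lexx orbT.
  - have : Num.min (e / 2) (r / 2) <= r / 2 by rewrite ge_min lexx orbT.
    by lra.
  - move=> z zy; apply: he; apply: (le_lt_trans zy).
    by rewrite gt_min; apply/orP; left; lra.
have [f hf] := choice step.
pose s := fix s n : X * R := if n is m.+1 then f (m, s m) else (0, 1).
have sY n : Y (s n).1 /\ 0 < (s n).2.
  elim: n => [|n [Yn pn]]/=; first by [].
  by have /= [//|//|? /andP[? _] _ _] := hf (n, s n).
have hs n := hf (n, s n) (sY n).1 (sY n).2.
have s2 n : (s n).2 <= 1 * (1 / 2) ^+ n.
  elim: n => [|n ih]; first by rewrite mulr1.
  rewrite /= exprS; have /= [_ /andP[_ h] _ _] := hs n.
  by apply: (le_trans h); lra.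
have sd k m : nrm ((s (k + m)%N).1 - (s k).1) + (s (k + m)%N).2 <= (s k).2.
  elim: m => [|m ih]; first by rewrite addn0 subrr nrm0 add0r.
  rewrite addnS; have /= [_ _ h _] := hs (k + m)%N; apply: le_trans ih.
  set a := (f _).1 in h *; set b := (f _).2 in h *.
  have := nrm_triangle a (s (k + m)%N).1 (s k).1; lra.
have half : 0 <= (1 / 2 : R) < 1 by lra.
have [|l sl] := @nrm_cauchy_cvg _ _ (fun n => (s n).1).
  move=> e e0; have [N hN] := expr_scaled_lt_eps 1 half e0.
  exists N => n /subnKC <-; apply: le_lt_trans (hN N (leqnn _)).
  apply: le_trans (s2 N); apply: le_trans (sd N (n - N)%N).
  by rewrite lerDl; exact: ltW (sY _).2.
have Yl : Y l.
  apply: ((closed_nrm _).1 cY) => e e0; move/cvg_nrm : sl => /(_ e e0)[N hN].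
  by exists (s N).1; [exact: (sY N).1|exact: hN].
have [k _ Fkl] := YF _ Yl.
have /= [_ _ _ /(_ l)] := hs k; apply => //.
apply: (nrm_lim_le (k := k.+1) sl) => n /subnKC <-.
by apply: le_trans (sd k.+1 (n - k.+1)%N); rewrite lerDl; exact: ltW (sY _).2.
Qed.

Section ClosedRelation.
Variables (X Z : completeNormedModType R[i]) (G : X -> Z -> Prop).
Hypothesis G0 : G 0 0.
Hypothesis G_linear : forall (a : R[i]^o) x x' y y',
  G x y -> G x' y' -> G (a *: x + x') (a *: y + y').
Hypothesis G_closed : forall x y,
  (forall e : R, 0 < e -> exists x' y', [/\ G x' y', nrm (x - x') < e & nrm (y - y') < e]) ->
  G x y.
Hypothesis G_closed_range : closed [set y | exists x, G x y].

Let GZ (a : R[i]^o) x y : G x y -> G (a *: x) (a *: y).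
Proof. by move=> /(G_linear a)/(_ G0); rewrite !addr0. Qed.

Let GD x x' y y' : G x y -> G x' y' -> G (x + x') (y + y').
Proof. by move=> /(G_linear 1) h/h; rewrite !scale1r. Qed.

Let GB x x' y y' : G x y -> G x' y' -> G (x - x') (y - y').
Proof.
by move=> g /(GZ (-1)); rewrite !scaleN1r => /(GD g).
Qed.

(** The closure of the image under [G] of the closed ball of radius [k]. *)
Let approx_ball (k : R) : set Z := [set y | forall e : R, 0 < e ->
  exists x y', [/\ G x y', nrm x <= k & nrm (y - y') < e]].

Let approx_ball_closed k : closed (approx_ball k).
Proof.
apply/closed_nrm => y hy e e0; have e2 : 0 < e / 2 by rewrite divr_gt0.
have [z hz yz] := hy _ e2; have [x [y' [g xk zy']]] := hz _ e2.
exists x, y'; split => //; apply: le_lt_trans (nrm_triangle _ z _) _.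
by rewrite (splitr e) ltrD.
Qed.

(** By Baire some [approx_ball k] contains a ball of the range around a point [y0]. A small [y] is
    the difference of [y + y0] and [y0], both in that ball, and scaling reaches every other [y]. *)
Let approx_open : exists2 C : R, 0 < C & forall y, (exists x, G x y) ->
  forall e : R, 0 < e -> exists x y', [/\ G x y', nrm x <= C * nrm y & nrm (y - y') < e].
Proof.
have [|||k [y0 [r [Yy0 r0 hr]]]] :=
    @baire_closed_cover Z [set y | exists x, G x y] (fun k => approx_ball k%:R) G_closed_range.
- by exists 0.
- by move=> k; exact: approx_ball_closed.
- move=> y [x g]; exists (Num.truncn (nrm x)).+1 => // e e0.
  exists x, y; split => //; last by rewrite subrr nrm0.
  by rewrite ltW// truncnS_gt.
case: Yy0 => x0 g0.
have k0 : 0 <= k%:R :> R by [].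
(* [2 * k] bounds the difference of two points of norm at most [k], and [2 / r] undoes the scaling
   of [y] to norm [r / 2]; the summand 1 keeps the constant positive when [k = 0]. *)
exists ((2 * k%:R + 1) * (2 / r)); first by rewrite mulr_gt0 ?divr_gt0//; lra.
move=> y [x g] e e0; have [->|y0n] := eqVneq y 0.
  by exists 0, 0; rewrite !nrm0 mulr0 subrr nrm0.
have ny := nrm_gt0 y0n.
pose t : R := r / 2 / nrm y; have t0 : 0 < t by rewrite !divr_gt0.
pose c : R[i]^o := t%:C.
have nc : nrm c = t by rewrite nrm_real gtr0_norm.
have c0 : c != 0 by apply/eqP => c0; move: nc; rewrite c0 nrm0 => /esym; lra.
have e2 : 0 < e * t / 2 by have := mulr_gt0 e0 t0; lra.
have [||u [v [guv uk hv]]] := hr (c *: y + y0) _ _ _ e2.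
- by exists (c *: x + x0); exact: G_linear.
- by rewrite addrK nrmZ nc /t mulfVK ?lt0r_neq0//; lra.
have [||u' [v' [guv' uk' hv']]] := hr y0 _ _ _ e2.
- by exists x0.
- by rewrite subrr nrm0.
have nVc : nrm (c^-1 : R[i]^o) = t^-1 by rewrite nrmV nc.
exists (c^-1 *: (u - u')), (c^-1 *: (v - v')); split.
- by apply: GZ; exact: GB.
- have tV : t^-1 = 2 / r * nrm y by rewrite /t; field; rewrite !lt0r_neq0.
  rewrite nrmZ nVc tV [leRHS](_ : _ = 2 / r * nrm y * (2 * k%:R + 1)); last by ring.
  have P : 0 <= 2 / r * nrm y by rewrite mulr_ge0 ?divr_ge0 ?ltW.
  rewrite ler_wpM2l//; have := nrmB u u'; move: uk uk' => /=; lra.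
- have -> : y - c^-1 *: (v - v') = c^-1 *: ((c *: y + y0 - v) - (y0 - v')).
    rewrite -[y in LHS](scalerK c0) -scalerBr; congr (_ *: _).
    by rewrite !opprB [v' - y0]addrC addrACA addrK [- v + v']addrC.
  rewrite nrmZ nVc mulrC ltr_pdivrMr//; have := nrmB (c *: y + y0 - v) (y0 - v').
  lra.
Qed.

(** Successive approximation: the bound on the residual halves at each stage, so the corrections sum
    to a preimage with constant [2 * C], and closedness of [G] passes to the limit. A relation
    covers an operator on a closed subspace as well as a projection whose boundedness is still to be
    proved. *)
Theorem closed_relation_open : exists2 C : R, 0 < C & forall x y, G x y ->
  exists2 x', G x' y & nrm x' <= C * nrm y.
Proof.
have [C C0 hC] := approx_open.
exists (2 * C); first by rewrite mulr_gt0.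
move=> x y g; have [y0|y0n] := eqVneq y 0.
  by exists 0; rewrite y0 ?nrm0 ?mulr0.
have ny := nrm_gt0 y0n.
have step (p : nat * Z) : exists uv : X * Z, (exists x, G x p.2) ->
    [/\ G uv.1 uv.2, nrm uv.1 <= C * nrm p.2 & nrm (p.2 - uv.2) < nrm y * (1 / 2) ^+ p.1.+1].
  case: p => n z; have [gz|ngz] := pselect (exists x, G x z); last by exists (0, 0).
  have [|u [v h]] := hC _ gz (nrm y * (1 / 2) ^+ n.+1); last by exists (u, v).
  by rewrite mulr_gt0// exprn_gt0//; lra.
have [f hf] := choice step.
pose z := fix z n := if n is m.+1 then z m - (f (m, z m)).2 else y.
pose u n := (f (n, z n)).1.
have zG n : exists x, G x (z n).
  elim: n => [|n [xn gn]]; first by exists x.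
  have [|gf _ _] := hf (n, z n); first by exists xn.
  by exists (xn - (f (n, z n)).1); apply: GB.
have hz n := hf (n, z n) (zG n).
have zn n : nrm (z n) <= nrm y * (1 / 2) ^+ n.
  case: n => [|n]; first by rewrite mulr1.
  by have /= [_ _ /ltW] := hz n.
have un n : nrm (u n) <= (C * nrm y) * (1 / 2) ^+ n.
  have /= [_ h _] := hz n; apply: (le_trans h).
  by rewrite -mulrA ler_wpM2l// ltW.
have half : 0 <= (1 / 2 : R) < 1 by lra.
have [l ul] := nrm_cauchy_cvg (geometric_nrm_cauchy half un).
have gS n : G (series u n) (y - z n).
  elim: n => [|n ih]; first by rewrite /series/= big_geq// subrr.
  rewrite /series/= big_nat_recr//= opprB addrCA addrC; apply: GD => //.
  by have /= [] := hz n.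
exists l.
  apply: G_closed => e e0.
  have [N1 h1] := expr_scaled_lt_eps (nrm y) half e0.
  move/cvg_nrm : ul => /(_ e e0)[N2 h2]; set n := maxn N1 N2.
  exists (series u n), (y - z n); split => //.
    by apply: h2; rewrite leq_maxr.
  by rewrite opprB addrCA subrr addr0 (le_lt_trans (zn n))// h1// leq_maxl.
have := geometric_tail half un ul 0%N; rewrite /series/= big_geq// subr0 expr0 mulr1.
by move/le_trans; apply; rewrite (_ : 1 - 1 / 2 = 2^-1 :> R); [rewrite invrK; lra|lra].
Qed.

End ClosedRelation.
End OpenMapping.

(** * Complex Hahn-Banach theorem *)

Section HahnBanach.
Variables (R : realType) (X : normedModType R[i]) (K : R).
Hypothesis K0 : 0 <= K.

Let p (x : X) : R := K * nrm x.

Let pD x y : p (x + y) <= p x + p y.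
Proof. by rewrite /p -mulrDr ler_wpM2l// nrmD. Qed.

Let pZ (r : R) x : 0 <= r -> p (r%:C *: x) = r * p x.
Proof. by move=> r0; rewrite /p nrmZ nrm_real ger0_norm// mulrCA. Qed.

(** Partial functionals are given by their graphs. A graph that is both linear and dominated is
    single-valued, since [p 0 = 0]. *)
Let real_linear (G : set (X * R)) := forall x u y v (t : R),
  G (x, u) -> G (y, v) -> G (t%:C *: x + y, t * u + v).

Let dominated (G : set (X * R)) := forall x u, G (x, u) -> u <= p x.

(** The value [c] at [x0] must lie between all [v - p (y - x0)] and all [p (x + x0) - u] with
    [(y, v)] and [(x, u)] in [G]; subadditivity of [p] leaves room for it. Negative [t] uses the
    lower bounds, positive [t] the upper ones. *)
Let extend_one (G : set (X * R)) x0 : G (0, 0) -> real_linear G -> dominated G ->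
  exists c : R, forall x u (t : R), G (x, u) -> t * c + u <= p (t%:C *: x0 + x).
Proof.
move=> G0 linG domG; pose S := [set xu.2 - p (xu.1 - x0) | xu in G].
have SU x u : G (x, u) -> ubound S (p (x + x0) - u).
  move=> g _ [[y v] /= h <-]; rewrite lerBrDl addrA lerBlDr.
  have := linG _ _ _ _ 1 g h; rewrite scale1r mul1r => /domG/le_trans; apply.
  by rewrite (_ : x + y = (x + x0) + (y - x0)) ?pD// addrACA subrr addr0.
have hS : has_sup S.
  split; first by exists (0 - p (0 - x0)), (0, 0).
  by exists (p (0 + x0) - 0); exact: SU.
exists (sup S) => x u t g.
have GZ (r : R) : G (r%:C *: x, r * u).
  by have := linG _ _ _ _ r g G0; rewrite !addr0.
have lo y v : G (y, v) -> v - p (y - x0) <= sup S.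
  by move=> h; apply: (ub_le_sup hS.2); exists (y, v).
have hi y v : G (y, v) -> sup S <= p (y + x0) - v.
  by move=> h; apply: (ge_sup hS.1); exact: SU.
have [t0|t0|->] := ltgtP t 0; last by rewrite scale0r mul0r !add0r; exact: domG.
- have s0 : 0 < - t by rewrite oppr_gt0.
  have := lo _ _ (GZ (- t)^-1).
  rewrite -(ler_pM2l s0) mulrBr mulrA mulfV ?lt0r_neq0// mul1r -(pZ _ (ltW s0)).
  rewrite scalerBr scalerA -rmorphM/= mulfV ?lt0r_neq0// scale1r.
  rewrite rmorphN/= scaleNr opprK [x + _]addrC mulNr; lra.
- have := hi _ _ (GZ t^-1).
  rewrite -(ler_pM2l t0) mulrBr [t * (_ * u)]mulrA mulfV ?lt0r_neq0// mul1r -(pZ _ (ltW t0)).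
  rewrite scalerDr scalerA -rmorphM/= mulfV ?lt0r_neq0// scale1r [x + _]addrC; lra.
Qed.

Let real_hahn_banach (G0 : set (X * R)) :
  G0 (0, 0) -> real_linear G0 -> dominated G0 ->
  exists G, [/\ G0 `<=` G, real_linear G, dominated G & forall x, exists u, G (x, u)].
Proof.
move=> G00 linG0 domG0.
pose good := [set G | G = set0 \/ [/\ G0 `<=` G, real_linear G & dominated G]].
have [F Fgood Fchain|G [Ggood Gmax]] := @Zorn_bigcup _ good.
  have [[A FA [a Aa]]|nA] := pselect (exists2 A, F A & A !=set0); last first.
    left; apply/seteqP; split => // a [A FA Aa]; apply: nA; exists A => //.
    by exists a.
  have gd B b : F B -> B b -> [/\ G0 `<=` B, real_linear B & dominated B].
    by move=> FB Bb; have [B0|//] := Fgood _ FB; rewrite B0 in Bb.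
  right; split.
  - by move=> g Gg; exists A => //; have [h _ _] := gd _ _ FA Aa; exact: h.
  - move=> x u y v t [B FB Bx] [C FC Cy].
    have [BC|CB] := Fchain _ _ FB FC.
      by exists C => //; have [_ h _] := gd _ _ FC Cy; exact: h (BC _ Bx) Cy.
    by exists B => //; have [_ h _] := gd _ _ FB Bx; exact: h Bx (CB _ Cy).
  - by move=> x u [B FB Bx]; have [_ _ h] := gd _ _ FB Bx; exact: h.
have {Ggood}[G00' linG domG] : [/\ G0 `<=` G, real_linear G & dominated G].
  case: Ggood => // G0E; exfalso; apply: (Gmax G0); last by right; split.
  by rewrite G0E; split => [? []|/(_ (0, 0) G00)[]].
exists G; split => // x0; apply: contrapT => nx0.
have G0' : G (0, 0) by exact: G00'.
have [c hc] := @extend_one G x0 G0' linG domG.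
pose G' : set (X * R) := [set z | exists x u (t : R),
  G (x, u) /\ z = (t%:C *: x0 + x, t * c + u)].
apply: (Gmax G').
  split => [[x u] g|G'G].
    by exists x, u, 0; rewrite scale0r mul0r !add0r.
  apply: nx0; exists c; apply: G'G; exists 0, 0, 1.
  by rewrite scale1r mul1r !addr0.
right; split.
- by move=> [x u] /G00' g; exists x, u, 0; rewrite scale0r mul0r !add0r.
- move=> _ _ _ _ t [x [u [r [g [-> ->]]]]] [y [v [s [h [-> ->]]]]].
  exists (t%:C *: x + y), (t * u + v), (t * r + s); split; first exact: linG.
  congr (_, _); last by ring.
  by rewrite rmorphD rmorphM/= scalerDl scalerDr scalerA -!addrA;
    congr (_ + _); rewrite addrCA.
- by move=> _ _ [x [u [r [g [-> ->]]]]]; exact: hc.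
Qed.

(** [H] is the graph of a functional on a subspace. Its real part extends to a real functional [u],
    and [u x - i u(i x)] is the complex-linear functional with real part [u]. *)
Theorem complex_hahn_banach (H : X -> R[i]^o -> Prop) :
  H 0 0 ->
  (forall (a : R[i]^o) x y (c d : R[i]^o), H x c -> H y d -> H (a *: x + y) (a * c + d)) ->
  (forall x c, H x c -> nrm c <= K * nrm x) ->
  exists2 phi : dual X, nrm phi <= K & forall x c, H x c -> phi x = c.
Proof.
move=> H0 linH domH.
pose G0 : set (X * R) := [set z | exists2 c, H z.1 c & z.2 = complex.Re c].
have [||| G [G0G linG domG totG]] := @real_hahn_banach G0.
- by exists 0.
- move=> x u y v t [c /= Hx ->] [d /= Hy ->]; exists (t%:C * c + d); first exact: linH.
  by rewrite raddfD/=; case: (c) => a b /=; rewrite mul0r subr0.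
- move=> x u [c /= Hx ->]; apply: le_trans (domH _ _ Hx).
  by apply: le_trans (Re_le_nrm _); exact: ler_norm.
have [u hu] := choice totG.
have G00 : G (0, 0) by apply: G0G; exists 0.
have uE x r : G (x, r) -> u x = r.
  move=> g.
  have le a b y : G (y, a) -> G (y, b) -> b <= a.
    move=> ga gb; have := linG _ _ _ _ (-1) ga gb.
    rewrite rmorphN rmorph1 scaleN1r addNr mulN1r => /domG.
    by rewrite /p nrm0 mulr0; lra.
  by apply/eqP; rewrite eq_le !(le _ _ x).
have uD x y : u (x + y) = u x + u y.
  by apply: uE; have := linG _ _ _ _ 1 (hu x) (hu y); rewrite scale1r mul1r.
have uZ (r : R) x : u (r%:C *: x) = r * u x.
  by apply: uE; have := linG _ _ _ _ r (hu x) G00; rewrite !addr0.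
have uN x : u (- x) = - u x.
  by rewrite -scaleN1r -(rmorph1 (real_complex R)) -rmorphN uZ mulN1r.
pose g x : R[i]^o := (u x) +i* (- u ('i%C *: x)).
have gD x y : g (x + y) = g x + g y.
  by rewrite /g scalerDr !uD; apply/eqP; rewrite eq_complex/= opprD !eqxx.
have gr (r : R) x : g (r%:C *: x) = r%:C * g x.
  rewrite /g scalerA mulrC -scalerA !uZ; apply/eqP; rewrite eq_complex/=.
  by apply/andP; split; apply/eqP; ring.
have gi x : g ('i%C *: x) = 'i%C * g x.
  rewrite /g scalerA -expr2 sqr_i scaleN1r uN; apply/eqP; rewrite eq_complex/=.
  by apply/andP; split; apply/eqP; ring.
have gZ (a : R[i]^o) x : g (a *: x) = a * g x.
  case: a => a b; have -> : (a +i* b) *: x = a%:C *: x + b%:C *: ('i%C *: x).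
    by rewrite scalerA -scalerDl [_ * 'i%C]mulrC; congr (_ *: _); rewrite [LHS]complexE.
  rewrite gD !gr gi mulrA -mulrDl; congr (_ * _).
  by rewrite [RHS]complexE/= [_ * 'i%C]mulrC.
have linear_g : linear (g : X -> R[i]^o) by move=> a x y; rewrite gD gZ.
have gK x : nrm (g x) <= K * nrm x.
  have [->|g0] := eqVneq (g x) 0; first by rewrite nrm0 mulr_ge0// nrm_ge0.
  have ng := nrm_gt0 g0.
  (* A factor of modulus one that rotates [g x] onto the positive real axis, where the bound on the
     real part becomes a bound on the modulus. *)
  pose a : R[i]^o := (nrm (g x))%:C / g x.
  have na : nrm a = 1.
    by rewrite nrmM nrmV nrm_real ger0_norm ?nrm_ge0// mulfV// lt0r_neq0.
  have := domG _ _ (hu (a *: x)); rewrite /p nrmZ na mul1r.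
  suff -> : u (a *: x) = nrm (g x) by [].
  rewrite -[LHS]/(complex.Re (g (a *: x))) gZ /a.
  by rewrite mulfVK.
have [phi phiE] := bounded_op_exists linear_g gK.
exists phi; first by apply: bop_nrm_le => // x; rewrite phiE.
move=> x c Hx; rewrite phiE /g (uE x (complex.Re c)); last first.
  by apply: G0G; exists c.
rewrite (uE _ (complex.Re ('i%C * c))); last first.
  apply: G0G; exists ('i%C * c) => //=.
  by have := linH 'i%C _ _ _ _ Hx H0; rewrite !addr0.
by apply/eqP; rewrite eq_complex; case: (c) => a b /=; apply/andP; split => //; apply/eqP; ring.
Qed.

End HahnBanach.

(** * Power series and analytic functions *)

Section Limits.
Variables (R : realType) (E : normedModType R[i]).
Implicit Types (u v : nat -> E) (l m : E).

Lemma seq_cvg_ext u v l : (forall n, u n = v n) -> u @ \oo --> l -> v @ \oo --> l.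
Proof. by move=> /funext ->. Qed.

Lemma seq_cvgB u v l m :
  u @ \oo --> l -> v @ \oo --> m -> (fun n => u n - v n) @ \oo --> l - m.
Proof. by move=> ul vm; exact: cvgB ul vm. Qed.

Lemma seq_cvgZ (a : R[i]^o) u l :
  u @ \oo --> l -> (fun n => a *: u n) @ \oo --> a *: l.
Proof. by move=> ul; exact: cvgZl_tmp ul. Qed.

Lemma seq_cvg_shift u v l : (forall n, v n.+1 = u n) -> u @ \oo --> l -> v @ \oo --> l.
Proof.
move=> vu /cvg_nrm ul; apply/cvg_nrm => e e0.
by have [N hN] := ul _ e0; exists N.+1 => -[//|n] /hN; rewrite vu.
Qed.

Lemma seq_cvg_near u l k : (forall n, (k <= n)%N -> u n = l) -> u @ \oo --> l.
Proof.
by move=> ul; apply/cvg_nrm => e e0; exists k => n /ul ->; rewrite subrr nrm0.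
Qed.

End Limits.

Section PowerSeries.
Variables (R : realType) (E : normedModType R[i]).
Implicit Types (a : nat -> E) (w z : R[i]^o) (F f : R[i]^o -> E).

Definition pseries a w : nat -> E := series (fun n => w ^+ n *: a n).

Lemma pseries0 a w : pseries a w 0 = 0.
Proof. by rewrite /pseries/series/= big_geq. Qed.

Lemma pseriesS a w n : pseries a w n.+1 = pseries a w n + w ^+ n *: a n.
Proof. by rewrite /pseries/series/= big_nat_recr. Qed.

(** Convergence at [r / 2] bounds the terms there by a constant [K]; for [nrm w < r / 4] the terms
    at [w] are then dominated by a geometric series of ratio at most 1/2. *)
Lemma pseries_remainder a F (r : R) : 0 < r ->
  (forall w, nrm w < r -> pseries a w @ \oo --> F w) ->
  forall m, exists C rho : R, 0 < rho /\
    forall w, nrm w < rho -> nrm (F w - pseries a w m) <= C * nrm w ^+ m.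
Proof.
move=> r0 aF m; have s0 : 0 < r / 2 by rewrite divr_gt0.
have [||N hN] := (cvg_nrm (pseries a (r / 2)%:C) (F (r / 2)%:C)).1 _ 1.
- by apply: aF; rewrite nrm_real gtr0_norm//; lra.
- by [].
pose t n := (r / 2) ^+ n * nrm (a n).
have t0 n : 0 <= t n by rewrite mulr_ge0 ?exprn_ge0 ?nrm_ge0// ltW.
have tE n : t n = nrm (pseries a (r / 2)%:C n.+1 - pseries a (r / 2)%:C n).
  by rewrite pseriesS addrAC subrr add0r nrmZ nrmX nrm_real gtr0_norm.
(* From index [N] on, a term is the difference of two partial sums within 1 of the limit, hence at
   most 2; the finite sum covers the earlier terms. *)
pose K := 2 + \sum_(i < N) t i.
have tK n : t n <= K.
  have [Nn|nN] := leqP N n; last first.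
    by rewrite /K (bigD1 (Ordinal nN))//= addrCA lerDl addr_ge0// sumr_ge0.
  rewrite tE /K; set x := pseries _ _ _; set y := pseries _ _ _.
  have := nrm_triangle x (F (r / 2)%:C) y; rewrite nrmBC.
  have := hN _ Nn; have := hN _ (leqW Nn); rewrite -/x -/y.
  have : 0 <= \sum_(i < N) t i by rewrite sumr_ge0.
  by rewrite nrmBC; lra.
have K0 : 0 <= K by apply: le_trans (tK 0%N).
have r4 : 0 < r / 4 by lra.
exists (K / (1 - 1 / 2) * (2 / r) ^+ m), (r / 4); split => // w wr.
pose q := nrm w * (2 / r).
have q01 : 0 <= q <= 1 / 2.
  rewrite /q mulr_ge0 ?nrm_ge0 ?divr_ge0 ?(ltW r0)//=.
  by rewrite mulrA ler_pdivrMr//; lra.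
have q1 : 0 <= q < 1 by lra.
have tq n : nrm (w ^+ n *: a n) <= K * q ^+ n.
  rewrite nrmZ nrmX /q exprMn mulrCA ler_wpM2l ?exprn_ge0 ?nrm_ge0//.
  rewrite -invf_div exprVn ler_pdivlMr ?exprn_gt0// mulrC.
  exact: tK.
have wr' : nrm w < r by lra.
have := geometric_tail q1 tq (aF _ wr') m; move/le_trans; apply.
rewrite [q ^+ m]exprMn [nrm w ^+ m * _]mulrC mulrA.
rewrite ler_wpM2r ?exprn_ge0 ?nrm_ge0// ler_wpM2r ?exprn_ge0 ?divr_ge0 ?(ltW r0)//.
by rewrite ler_wpM2l// lef_pV2 ?posrE; lra.
Qed.

Lemma pseries_continuous a F (r : R) : 0 < r ->
  (forall w, nrm w < r -> pseries a w @ \oo --> F w) ->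
  forall e : R, 0 < e -> exists2 d : R, 0 < d & forall w, nrm w < d -> nrm (F w - F 0) < e.
Proof.
move=> r0 aF e e0; have [C [d [d0 hC]]] := pseries_remainder r0 aF 1.
have F0 : F 0 = a 0.
  apply: (cvg_nrm_unique (aF 0 _)); first by rewrite nrm0.
  apply: (@seq_cvg_near _ _ _ _ 1) => -[//|n _].
  elim: n => [|n ih]; first by rewrite pseriesS pseries0 expr0 scale1r add0r.
  by rewrite pseriesS ih expr0n scale0r addr0.
have C1 : 0 < `|C| + 1 by rewrite ltr_wpDl.
exists (Num.min d (e / (`|C| + 1))) => [|w]; first by rewrite lt_min d0 divr_gt0.
rewrite lt_min => /andP[/hC + we]; rewrite F0 pseriesS pseries0 add0r expr0 scale1r expr1.
move=> h; apply: (le_lt_trans h); move: we; rewrite ltr_pdivlMr// => we.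
apply: le_lt_trans we; rewrite mulrC ler_wpM2l ?nrm_ge0//.
by rewrite (le_trans (ler_norm _))// lerDl.
Qed.

(** If [a i = 0] for [i < n], the remainder estimate at a zero [w] of [F] bounds [nrm (a n)] by a
    multiple of [nrm w], and [w] can be taken arbitrarily small. Zeros accumulating at 0 suffice, so
    an identity known only off 0 can be compared coefficientwise. *)
Lemma pseries_unique a F (r : R) : 0 < r ->
  (forall w, nrm w < r -> pseries a w @ \oo --> F w) ->
  (forall e : R, 0 < e -> exists w, [/\ w != 0, nrm w < e & F w = 0]) ->
  forall n, a n = 0.
Proof.
move=> r0 aF F0 n; elim/ltn_ind : n => n ih.
have S0 w : pseries a w n.+1 = w ^+ n *: a n.
  by rewrite pseriesS /pseries/series/= big_nat big1 ?add0r// => i /ih ->; rewrite scaler0.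
have [C [d [d0 hC]]] := pseries_remainder r0 aF n.+1.
apply: nrm_small_eq0 => e e0; have C1 : 0 < `|C| + 1 by rewrite ltr_wpDl.
have [|w [w0 + Fw]] := F0 (Num.min d (e / (`|C| + 1))).
  by rewrite lt_min d0 divr_gt0.
rewrite lt_min => /andP[/hC]; rewrite Fw sub0r nrmN S0 nrmZ nrmX exprSr mulrCA.
rewrite ler_pM2l ?exprn_gt0 ?nrm_gt0// ltr_pdivlMr// => h we.
apply: (le_lt_trans h); apply: le_lt_trans we; rewrite mulrC ler_wpM2l ?nrm_ge0//.
by rewrite (le_trans (ler_norm _))// lerDl.
Qed.

Lemma analytic_onP f (z0 : R[i]^o) (e : R) : analytic_on f (ball z0 e%:C) <->
  forall z, nrm (z - z0) < e -> exists a (r : R), 0 < r /\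
    forall w, nrm w < r -> pseries a w @ \oo --> f (z + w).
Proof.
split=> [fa z /ball_nrm /fa[a [_ [/complex_gt0[r r0 ->] h]]]|fa z /ball_nrm/fa[a [r [r0 h]]]].
  exists a, r; split => // w wr.
  have := h (z + w); rewrite addrAC subrr add0r; apply.
  by apply/ball_nrm; rewrite addrAC subrr add0r.
exists a, r%:C; split; first by rewrite ltcR.
by move=> w /ball_nrm /h; rewrite addrCA subrr addr0.
Qed.

Section IdentityTheorem.
Variables (f : R[i]^o -> E) (z0 : R[i]^o) (e : R).
Hypothesis f_analytic : analytic_on f (ball z0 e%:C).

Lemma analytic_zero_nbhs z : nrm (z - z0) < e ->
  (forall d : R, 0 < d -> exists w, [/\ w != z, nrm (w - z) < d & f w = 0]) ->
  exists2 d : R, 0 < d & forall w, nrm (w - z) < d -> f w = 0.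
Proof.
move=> ze acc; have [a [r [r0 aF]]] := (analytic_onP _ _ _).1 f_analytic _ ze.
have a0 : forall n, a n = 0.
  apply: (pseries_unique r0 aF) => d d0; have [w [wz wd fw]] := acc _ d0.
  by exists (w - z); rewrite subr_eq0 addrCA subrr addr0.
exists r => // w wr; have := aF _ wr; rewrite addrCA subrr addr0 => h.
apply: (cvg_nrm_unique h); apply: (@seq_cvg_near _ _ _ _ 0) => n _.
by rewrite /pseries/series/= big1 => // i _; rewrite a0 scaler0.
Qed.

(** Follow the segment [g] from [z0] to [z1] and let [s] be the supremum of the [t] for which [f]
    vanishes on the part up to [t]. Zeros accumulate at [g s], so [f] vanishes on a disc around it,
    and [s < 1] would contradict the choice of [s]. *)
Theorem analytic_identity : 0 < e ->
  (forall d : R, 0 < d -> exists w, [/\ w != z0, nrm (w - z0) < d & f w = 0]) ->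
  forall z, nrm (z - z0) < e -> f z = 0.
Proof.
move=> e0 acc z1 z1e.
have [|d0 d00 h0] := analytic_zero_nbhs _ acc; first by rewrite subrr nrm0.
have [->|z10] := eqVneq z1 z0; first by apply: h0; rewrite subrr nrm0.
set D := nrm (z1 - z0) in z1e.
have D0 : 0 < D by rewrite nrm_gt0// subr_eq0.
pose g (t : R) : R[i]^o := z0 + t%:C * (z1 - z0).
have gB s t : nrm (g s - g t) = `|s - t| * D.
  by rewrite /g opprD addrACA subrr add0r -mulrBl nrmM -rmorphB nrm_real.
have g0 : g 0 = z0 by rewrite /g mul0r addr0.
have g1 : g 1 = z1 by rewrite /g mul1r addrCA subrr addr0.
pose A := [set t : R | 0 <= t <= 1 /\ forall s, 0 <= s <= t -> f (g s) = 0].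
have small (d : R) : 0 < d -> 0 < d / (2 * D) /\ d / (2 * D) * D < d.
  move=> dp; split; first by rewrite divr_gt0 ?mulr_gt0.
  by rewrite invfM mulrA mulfVK ?lt0r_neq0//; lra.
have [t0 t0D] := small _ d00.
pose t1 := Num.min 1 (d0 / (2 * D)).
have t1E : 0 < t1 /\ t1 <= d0 / (2 * D).
  by rewrite lt_min ltr01 t0 ge_min lexx orbT.
have At1 : A t1.
  split=> [|s /andP[s0 st]]; first by rewrite (ltW t1E.1) ge_min lexx.
  apply: h0; rewrite -g0 gB subr0 ger0_norm//.
  by apply: le_lt_trans t0D; rewrite ler_wpM2r// ?(ltW D0)// (le_trans st) ?t1E.2.
have hA : has_sup A by split; [exists t1|exists 1 => t [/andP[]]].
set s := sup A.
have s0 : 0 < s by apply: lt_le_trans t1E.1 _; exact: (ub_le_sup hA.2).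
have s1 : s <= 1 by apply: (ge_sup hA.1) => t [/andP[]].
have zero_below t : 0 <= t < s -> f (g t) = 0.
  move=> /andP[tp ts]; have [|u [_ hu] su] := @sup_adherent _ A (s - t) _ hA.
    by rewrite subr_gt0.
  by apply: hu; rewrite tp /=; move: su; rewrite -/s; lra.
have [||d dp hd] := @analytic_zero_nbhs (g s).
- rewrite -g0 gB subr0 gtr0_norm//; apply: le_lt_trans z1e.
  by rewrite ler_piMl ?(ltW D0).
- move=> d dp; have [u0 uD] := small _ dp.
  pose t := s - Num.min s (d / (2 * D)).
  have m0 : 0 < Num.min s (d / (2 * D)) by rewrite lt_min s0 u0.
  have ms : Num.min s (d / (2 * D)) <= s by rewrite ge_min lexx.
  have md : Num.min s (d / (2 * D)) <= d / (2 * D) by rewrite ge_min lexx orbT.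
  have gts : nrm (g t - g s) = Num.min s (d / (2 * D)) * D.
    by rewrite gB /t addrAC subrr add0r normrN gtr0_norm.
  exists (g t); split.
  + apply/eqP => gE; move: gts; rewrite gE subrr nrm0 => /esym/eqP.
    by rewrite mulf_eq0 !gt_eqF.
  + by rewrite gts; apply: le_lt_trans uD; rewrite ler_wpM2r ?(ltW D0).
  + by apply: zero_below; rewrite /t; lra.
have [u0 uD] := small _ dp.
have near_zero t : s <= t <= s + d / (2 * D) -> f (g t) = 0.
  move=> /andP[st tsd]; apply: hd; rewrite gB ger0_norm ?subr_ge0//.
  by apply: le_lt_trans uD; rewrite ler_wpM2r ?(ltW D0)//; lra.
have [s_lt1|s_ge1] := ltP s 1; last first.
  by rewrite -g1; apply: near_zero; lra.
pose t2 := Num.min 1 (s + d / (2 * D)).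
have t2E : [/\ s < t2, t2 <= 1 & t2 <= s + d / (2 * D)].
  by rewrite lt_min s_lt1 ltrDl u0 !ge_min !lexx orbT.
case: t2E => st2 t21 t2d.
have At2 : A t2.
  split=> [|t /andP[tp tt2]]; first by rewrite t21 andbT; lra.
  have [ts|st] := ltP t s; first by apply: zero_below; rewrite tp.
  by apply: near_zero; rewrite st; lra.
by exfalso; have := ub_le_sup hA.2 At2; rewrite -/s; lra.
Qed.

End IdentityTheorem.

(** A predicate rather than a structure, so that it can be proved for [dual X] and passed as a
    hypothesis. *)
Definition nrm_complete := forall u : nat -> E, nrm_cauchy u -> exists l : E, u @ \oo --> l.

Section Reexpansion.
Variables (a : nat -> E) (K c : R) (F : R[i]^o -> E).
Hypotheses (E_complete : nrm_complete) (c0 : 0 < c).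
Hypothesis a_bound : forall n, nrm (a n) <= K * c ^+ n.
Hypothesis aF : forall w, nrm w < c^-1 -> pseries a w @ \oo --> F w.

(** The expansion at [z] comes from the binomial formula for [(z + w) ^+ n]: its [k]-th coefficient
    [psi k] is the sum over [n] of [t k n]. *)
Lemma pseries_analytic : analytic_on F (ball (0 : R[i]^o) (c^-1)%:C).
Proof.
apply/analytic_onP => z; rewrite subr0 => zc.
have K0 : 0 <= K.
  by have := le_trans (nrm_ge0 _) (a_bound 0%N); rewrite expr0 mulr1.
(* Half the distance from [z] to the boundary circle, so that [q = c * (nrm z + d)] stays below
   1. *)
pose d := (c^-1 - nrm z) / 2.
have d0 : 0 < d by rewrite divr_gt0// subr_gt0.
have zd0 : 0 <= nrm z + d by rewrite addr_ge0 ?nrm_ge0 ?ltW.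
pose q := c * (nrm z + d).
have q01 : 0 <= q < 1.
  rewrite /q mulr_ge0 ?(ltW c0)//= mulrC -ltr_pdivlMr// div1r /d; lra.
pose t k n := ('C(n, k)%:R * z ^+ (n - k) : R[i]^o) *: a n.
have nt k n : nrm ('C(n, k)%:R * z ^+ (n - k) : R[i]^o) * d ^+ k <= (nrm z + d) ^+ n.
  have [kn|nk] := leqP k n; last first.
    by rewrite bin_small// mul0r nrm0 mul0r exprn_ge0.
  rewrite nrmM nrm_nat nrmX exprDn.
  have kn' : (k < n.+1)%N by rewrite ltnS.
  rewrite (bigD1 (Ordinal kn'))//= -mulrA mulr_natl lerDl sumr_ge0// => i _.
  by rewrite mulrn_wge0// mulr_ge0 ?exprn_ge0 ?nrm_ge0// ltW.
have tb k n : nrm (t k n) <= K / d ^+ k * q ^+ n.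
  rewrite /t nrmZ mulrAC ler_pdivlMr ?exprn_gt0// mulrAC.
  apply: (@le_trans _ _ ((nrm z + d) ^+ n * (K * c ^+ n))).
    by apply: ler_pM => //; rewrite ?mulr_ge0 ?nrm_ge0 ?exprn_ge0// ltW.
  by rewrite /q exprMn mulrC mulrA.
have /choice[psi hpsi] : forall k, exists l : E, series (t k) @ \oo --> l.
  by move=> k; apply: E_complete; exact: geometric_nrm_cauchy q01 (tb k).
exists psi, d; split => // w wd.
(* This avoids interchanging a double series. [v m i] is the [i]-th term without the part of degree
   below [m] in [w]; it is zero for [i < m] and at most [K * q ^+ i] in norm. Hence its sum over
   [i], which is [F (z + w)] minus the [m]-th partial sum of the new series, is bounded by a
   geometric tail. *)
pose v m i := (z + w) ^+ i *: a i - \sum_(0 <= k < m) w ^+ k *: t k i.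
have seriesv m n : series (v m) n =
    pseries a (z + w) n - \sum_(0 <= k < m) w ^+ k *: series (t k) n.
  rewrite /pseries/series/= sumrB; congr (_ - _); rewrite exchange_big/=.
  by apply: eq_bigr => k _; rewrite scaler_sumr.
have cvgv m : series (v m) @ \oo --> F (z + w) - pseries psi w m.
  apply: (@seq_cvg_ext _ _ (fun n => pseries a (z + w) n -
      \sum_(0 <= k < m) w ^+ k *: series (t k) n)) => [n|].
    by rewrite seriesv.
  apply: seq_cvgB.
    apply: aF; apply: (le_lt_trans (nrmD _ _)); move: wd; rewrite /d; lra.
  elim: m => [|m ih].
    by rewrite pseries0; apply: (@seq_cvg_near _ _ _ _ 0) => n _; rewrite big_geq.
  rewrite pseriesS; have := seq_cvgB ih (seq_cvgZ (a := - w ^+ m) (hpsi m)).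
  rewrite scaleNr opprK; apply: seq_cvg_ext => n.
  by rewrite big_nat_recr//= scaleNr opprK.
have vE m i : v m i = (\sum_(m <= k < maxn m i.+1)
    w ^+ k * ('C(i, k)%:R * z ^+ (i - k)) : R[i]^o) *: a i.
  have -> : v m i = ((z + w) ^+ i -
      \sum_(0 <= k < m) w ^+ k * ('C(i, k)%:R * z ^+ (i - k)) : R[i]^o) *: a i.
    rewrite scalerBl scaler_suml; congr (_ - _).
    by apply: eq_bigr => k _; rewrite /t scalerA.
  congr (_ *: _); apply/eqP; rewrite subr_eq [X in _ == X]addrC -big_cat_nat ?leq_maxl//=.
  rewrite exprDn -(big_mkord xpredT (fun k => z ^+ (i - k) * w ^+ k *+ 'C(i, k))).
  rewrite (@big_cat_nat _ _ _ i.+1 0 (maxn m i.+1))//= ?leq_maxr//.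
  rewrite (_ : \sum_(i.+1 <= k < _) _ = 0) ?addr0; last first.
    rewrite big_nat big1// => k /andP[ik _].
    by rewrite bin_small// mul0r mulr0.
  by apply/eqP/eq_bigr => k _; rewrite -mulr_natl mulrA mulrC.
have vb m i : nrm (v m i) <= K * q ^+ i.
  rewrite vE nrmZ; apply: (@le_trans _ _ ((nrm z + d) ^+ i * (K * c ^+ i))); last first.
    by rewrite /q exprMn mulrC mulrA.
  apply: ler_pM => //; rewrite ?nrm_ge0//.
  apply: (le_trans (nrm_sum _ _ _)).
  pose G k : R := d ^+ k * ('C(i, k)%:R * nrm z ^+ (i - k)).
  have G0 k : 0 <= G k by rewrite /G !mulr_ge0 ?exprn_ge0 ?nrm_ge0// ltW.
  apply: (@le_trans _ _ (\sum_(0 <= k < maxn m i.+1) G k)).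
    rewrite (@big_cat_nat _ _ _ m 0 (maxn m i.+1))//= ?leq_maxl//.
    apply: ler_wpDl; first exact: sumr_ge0.
    apply: ler_sum => k _; rewrite /G !nrmM nrm_nat !nrmX ler_wpM2r//.
      by rewrite mulr_ge0 ?exprn_ge0 ?nrm_ge0.
    by rewrite lerXn2r ?nnegrE ?nrm_ge0 ?(ltW d0)// ltW.
  rewrite (@big_cat_nat _ _ _ i.+1 0 (maxn m i.+1))//= ?leq_maxr//.
  rewrite (_ : \sum_(i.+1 <= k < _) _ = 0) ?addr0; last first.
    rewrite big_nat big1// => k /andP[ik _].
    by rewrite /G bin_small// mul0r mulr0.
  rewrite exprDn -(big_mkord xpredT (fun k => nrm z ^+ (i - k) * d ^+ k *+ 'C(i, k))).
  by apply: ler_sum => k _; rewrite /G -mulr_natl; lra.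
apply/cvg_nrm => e e0.
have [N hN] := expr_scaled_lt_eps (K / (1 - q)) q01 e0.
exists N => m /hN; apply: le_lt_trans.
have := geometric_tail q01 (vb m) (cvgv m) m; rewrite [X in _ - X](_ : _ = 0) ?subr0//.
rewrite /series/= big_nat big1// => i /andP[_ im].
by rewrite vE (maxn_idPl im) big_geq// scale0r.
Qed.

End Reexpansion.

End PowerSeries.

Lemma dual_complete (R : realType) (X : normedModType R[i]) : nrm_complete (dual X).
Proof.
move=> u uc.
have unB n m x : nrm (u n x - u m x) <= nrm (u n - u m) * nrm x.
  by have := bop_nrm_bound (u n - u m) x.
have /choice[l ul] : forall x, exists l : R[i]^o, (fun n => u n x) @ \oo --> l.
  move=> x; apply: complex_cauchy_cvg => e e0.
  have x1 : 0 < nrm x + 1 by rewrite ltr_wpDl// nrm_ge0.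
  have [N hN] := uc _ (divr_gt0 e0 x1); exists N => n /hN; rewrite ltr_pdivlMr// => h.
  by apply: le_lt_trans h; rewrite (le_trans (unB _ _ _))// ler_wpM2l ?nrm_ge0// lerDl.
have [N1 hN1] := uc _ ltr01.
have linear_l : linear (l : X -> R[i]^o).
  move=> c x y; apply: (cvg_nrm_unique (ul _)).
  have := seq_cvgB (seq_cvgZ (a := c) (ul x)) (seq_cvgZ (a := -1) (ul y)).
  rewrite scaleN1r opprK; apply: seq_cvg_ext => n.
  by rewrite scaleN1r opprK linearP.
have lK x : nrm (l x) <= (1 + nrm (u N1)) * nrm x.
  rewrite -[l x](subrK (u N1 x)) (le_trans (nrmD _ _))// mulrDl lerD ?bop_nrm_bound//.
  apply: (nrm_lim_le (k := N1) (ul x)) => n /hN1 h.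
  by rewrite (le_trans (unB _ _ _))// ler_wpM2r ?nrm_ge0// ltW.
have [g gl] := bounded_op_exists linear_l lK.
exists g; apply/cvg_nrm => e e0; have e4 : 0 < e / 4 by lra.
have e24 : e / 2 = e / 4 + e / 4 by lra.
have [N hN] := uc _ e4; exists N => n Nn.
suff : nrm (g - u n) <= e / 2 by lra.
apply: bop_nrm_le => [|x]; first by lra.
rewrite -[_ x]/(g x - u n x) gl.
apply: (nrm_lim_le (k := N) (ul x)) => m Nm; apply: (le_trans (unB _ _ _)).
rewrite ler_wpM2r ?nrm_ge0//; apply: le_trans (nrm_triangle _ (u N) _) _.
rewrite e24; apply: lerD; first exact: ltW (hN _ Nm).
by rewrite nrmBC; exact: ltW (hN _ Nn).
Qed.

(** * Coefficientwise operations on power series *)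

Section PowerSeriesAlgebra.
Variables (R : realType) (E F : normedModType R[i]).

Lemma bop_mapD (L : bounded_op E F) x y : L (x + y) = L x + L y.
Proof. exact: raddfD. Qed.

Lemma bop_mapB (L : bounded_op E F) x y : L (x - y) = L x - L y.
Proof. exact: raddfB. Qed.

Lemma bop_mapN (L : bounded_op E F) x : L (- x) = - L x.
Proof. exact: raddfN. Qed.

Lemma bop_map0 (L : bounded_op E F) : L 0 = 0.
Proof. exact: raddf0. Qed.

Lemma bop_mapZ (L : bounded_op E F) (c : R[i]) x : L (c *: x) = c *: L x.
Proof. exact: linearZ. Qed.

Implicit Types (a b : nat -> E) (w : R[i]^o).

Lemma pseriesB a b w (l m : E) : pseries a w @ \oo --> l -> pseries b w @ \oo --> m ->
  pseries (fun k => a k - b k) w @ \oo --> l - m.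
Proof.
move=> al bm; apply: seq_cvg_ext (seq_cvgB al bm) => n.
by rewrite /pseries/series/= -sumrB; apply: eq_bigr => k _; rewrite scalerBr.
Qed.

Lemma pseries_map (L : bounded_op E F) a w (l : E) : pseries a w @ \oo --> l ->
  pseries (fun k => L (a k)) w @ \oo --> L l.
Proof.
move=> al; have := bop_cvg (f := L) al; apply: seq_cvg_ext => n /=.
by rewrite /pseries/series/= linear_sum; apply: eq_bigr => k _; rewrite linearZ.
Qed.

Lemma pseries_shift a w (l : E) : pseries a w @ \oo --> l ->
  pseries (fun k => if k is j.+1 then a j else 0) w @ \oo --> w *: l.
Proof.
move=> al; apply: seq_cvg_shift (seq_cvgZ (a := w) al) => n.
rewrite /pseries/series/= big_nat_recl//= scaler0 add0r scaler_sumr.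
by apply: eq_bigr => k _; rewrite exprS scalerA.
Qed.

Lemma pseries_delta w n (x : E) :
  pseries (fun k => if k == n then x else 0) w @ \oo --> w ^+ n *: x.
Proof.
apply: (@seq_cvg_near _ _ _ _ n.+1) => m nm; rewrite /pseries/series/= big_mkord.
rewrite (bigD1 (Ordinal nm))//= eqxx big1 ?addr0// => k.
by rewrite -val_eqE/= => /negPf ->; rewrite scaler0.
Qed.

Lemma bop_eval_exists (x : E) :
  exists ev : bounded_op (bounded_op E F) F, forall g, ev g = g x.
Proof.
apply: (@bounded_op_exists _ _ _ (fun g : bounded_op E F => g x) (nrm x)) => [c g h //|g].
by rewrite mulrC bop_nrm_bound.
Qed.

End PowerSeriesAlgebra.

Lemma pseries_eval (R : realType) (E F : normedModType R[i])
    (a : nat -> bounded_op E F) (w : R[i]^o) (g : bounded_op E F) x : pseries a w @ \oo --> g ->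
  pseries (fun k => a k x) w @ \oo --> g x.
Proof.
have [ev evE] := bop_eval_exists F x; move=> /(pseries_map (L := ev)); rewrite evE.
by under [in X in X -> _]eq_fun do rewrite evE.
Qed.

Section Iterates.
Variables (R : realType) (E : normedModType R[i]) (D : bounded_op E E).

Lemma iter_linear n : linear (iter n D).
Proof. by elim: n => [|n ih] c x y //=; rewrite ih linearP. Qed.

Lemma iter_bopD n x y : iter n D (x + y) = iter n D x + iter n D y.
Proof. by have := iter_linear n 1 x y; rewrite !scale1r. Qed.

Lemma iter_bop0 n : iter n D 0 = 0.
Proof. by elim: n => //= n ->; rewrite linear0. Qed.

Lemma iter_commute (A : E -> E) n x : (forall y, A (D y) = D (A y)) ->
  A (iter n D x) = iter n D (A x).
Proof. by move=> AD; elim: n => //= n <-; rewrite AD. Qed.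

Lemma closed_kernel (F : normedModType R[i]) (L : bounded_op E F) :
  closed [set x | L x = 0].
Proof.
apply/closed_nrm => x hx /=; apply: nrm_small_eq0 => e e0.
have L1 : 0 < nrm L + 1 by rewrite ltr_wpDl// nrm_ge0.
have [y /= Ly] := hx _ (divr_gt0 e0 L1).
rewrite ltr_pdivlMr// => h; rewrite -[L x]subr0 -Ly -raddfB.
apply: le_lt_trans h; rewrite (le_trans (bop_nrm_bound _ _))// mulrC.
by rewrite ler_wpM2l ?nrm_ge0// lerDl.
Qed.

End Iterates.

(** * Powers of an operator at a pole of its resolvent *)

Section Poles.
Variables (R : realType) (E : normedModType R[i]) (S : bounded_op E E).

Lemma not_limit_point_nrm (A : set R[i]^o) (z0 : R[i]^o) : ~ limit_point A z0 ->
  exists2 d : R, 0 < d & forall z, z != z0 -> nrm (z - z0) < d -> ~ A z.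
Proof.
move=> nlim; apply: contrapT => nd; apply: nlim => U /nbhs_nrm[d d0 dU].
apply: contrapT => nz; apply: nd; exists d => // z zz0 zd Az.
by apply: nz; exists z; split => //; exact: dU.
Qed.

Lemma resolvent_inverse (z : R[i]^o) : ~ spectrum S z ->
  is_inverse (S - z *: bop_id E) (resolvent S z).
Proof. by move=> /contrapT; exact: xgetPex. Qed.

(* With [g = sum_k w^k a_k] the expansion of [w^n (S - mu - w)^-1] at the pole
   [mu], comparing coefficients in [(D - w) g = w^n] gives [D a_0 = 0],
   [D a_k = a_(k-1)] and [D a_n = a_(n-1) + 1]; hence [D^n = D^(n+1) a_n] and
   [R(D^n) = N(a_(n-1))]. *)
Lemma pole_range (mu : R[i]^o) (D := S - mu *: bop_id E) :
  ~ limit_point (spectrum S) mu -> pole (resolvent S) mu ->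
  exists n, closed (range (iter n D)) /\
    forall x, exists y, iter n D x = iter n.+1 D y.
Proof.
move=> /not_limit_point_nrm[d d0 hd] [n [_ [g [n0 /complex_gt0[r r0 ->] ga _ gE]]]].
have [a [s [s0 hs]]] : exists a (s : R), 0 < s /\
    forall w, nrm w < s -> pseries a w @ \oo --> g (mu + w).
  by apply: ((analytic_onP _ _ _).1 ga mu); rewrite subrr nrm0.
(* The resolvent [w ^- n *: g (mu + w)] is a two-sided inverse of [D - w]; clearing denominators on
   both sides gives the equation for [g] and its commuting with [D]. *)
have gP w : w != 0 -> nrm w < Num.min d r -> forall x,
    D (g (mu + w) x) - w *: g (mu + w) x = w ^+ n *: x /\
    D (g (mu + w) x) = g (mu + w) (D x).
  rewrite lt_min => w0 /andP[wd wr] x; set z := mu + w.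
  have zmu : z - mu = w by rewrite /z addrAC subrr add0r.
  have z_neq : z != mu by rewrite -subr_eq0 zmu.
  have [] : is_inverse (S - z *: bop_id E) (resolvent S z).
    by apply: resolvent_inverse; apply: hd => //; rewrite zmu.
  rewrite gE//; last by apply/ball_nrm; rewrite zmu.
  rewrite zmu => inv1 inv2.
  have wn0 : w ^+ n != 0 by rewrite expf_eq0 negb_and w0 orbT.
  have DE y : D y = (S - z *: bop_id E) y + w *: y.
    rewrite /D -[_ y]/(S y - mu *: y) -[(S - z *: bop_id E) y]/(S y - z *: y).
    by rewrite /z scalerDl opprD addrA subrK.
  have e2 y : (S - z *: bop_id E) (g z y) = w ^+ n *: y.
    have h : (S - z *: bop_id E) (w ^- n *: g z y) = y.
      exact: (congr1 (fun h : bounded_op E E => h y) inv2).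
    by rewrite -[y in RHS]h bop_mapZ scalerA mulfV// scale1r.
  have e1 y : g z ((S - z *: bop_id E) y) = w ^+ n *: y.
    have h : w ^- n *: g z ((S - z *: bop_id E) y) = y.
      exact: (congr1 (fun h : bounded_op E E => h y) inv1).
    by rewrite -[y in RHS]h scalerA mulfV// scale1r.
  by rewrite !DE e2 bop_mapD bop_mapZ e1; split => //; rewrite addrK.
have small (e : R) : 0 < e -> exists w : R[i]^o,
    [/\ w != 0, nrm w < e, nrm w < Num.min d r & nrm w < s].
  have m0 : 0 < Num.min d r by rewrite lt_min d0.
  move: (Num.min d r) m0 => m m0 e0; pose t := Num.min e (Num.min m s).
  have t0 : 0 < t by rewrite !lt_min e0 m0.
  have [te td ts] : [/\ t <= e, t <= m & t <= s].
    by rewrite /t !ge_min !lexx !orbT.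
  exists (t / 2)%:C; rewrite !nrm_real gtr0_norm ?divr_gt0//; split; try lra.
  by apply/eqP => /(congr1 (@nrm R _)); rewrite nrm_real nrm0 gtr0_norm ?divr_gt0//; lra.
(* The equation is known for small [w != 0] only, which is enough for [pseries_unique]. *)
have coef x k : D (a k x) - (if k is j.+1 then a j x else 0) - (if k == n then x else 0) = 0.
  move: k; apply: (@pseries_unique _ _ _ (fun w => D (g (mu + w) x) -
      w *: g (mu + w) x - w ^+ n *: x) s s0) => [w ws|e /small[w [w0 we wd ws]]].
    have h := pseries_eval (x := x) (hs _ ws).
    apply: pseriesB; last exact: pseries_delta.
    by apply: pseriesB; [exact: (pseries_map (L := D) h)|exact: pseries_shift h].
  by exists w; split => //; have [-> _] := gP _ w0 wd x; rewrite subrr.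
have comm x k : D (a k x) - a k (D x) = 0.
  move: k; apply: (@pseries_unique _ _ _ (fun w => D (g (mu + w) x) -
      g (mu + w) (D x)) s s0) => [w ws|e /small[w [w0 we wd ws]]].
    have h := pseries_eval (x := D x) (hs _ ws).
    by apply: pseriesB (pseries_map (L := D) (pseries_eval (x := x) (hs _ ws))) h.
  by exists w; split => //; have [_ ->] := gP _ w0 wd x; rewrite subrr.
(* The order of the pole is [n.+1] from here on: [a n] is the residue of the resolvent and [a n.+1]
   the first regular coefficient. *)
case: n n0 gE gP coef => // n _ _ _ coef.
have nil x k : (k <= n)%N -> iter k.+1 D (a k x) = 0.
  elim: k => [|k ih] kn.
    by have := coef x 0%N; rewrite /= !subr0.
  rewrite iterSr; have := coef x k.+1; rewrite ltn_eqF ?ltnS// subr0.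
  by move=> /subr0_eq ->; rewrite ih// ltnW.
have Dan x : D (a n.+1 x) = a n x + x.
  by have := coef x n.+1; rewrite eqxx => /subr0_eq/eqP; rewrite subr_eq addrC => /eqP.
have acomm k x : a k (D x) = D (a k x) by apply/esym/subr0_eq.
exists n.+1; split; last first.
  by move=> x; exists (a n.+1 x); rewrite [RHS]iterSr Dan iter_bopD nil// add0r.
suff -> : range (iter n.+1 D) = [set x | a n x = 0] by exact: closed_kernel.
apply/seteqP; split => [_ [x _ <-]|y /= any].
  by change (a n (iter n.+1 D x) = 0); rewrite iter_commute// nil.
(* On the kernel of [a n] the operator [a n.+1] is a right inverse of [D]; since the two commute,
   its powers invert those of [D] there. *)
have yE : D (a n.+1 y) = y by rewrite Dan any add0r.
have yj j : iter j D (iter j (a n.+1) y) = y.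
  elim: j => [//|j ih]; rewrite [iter j.+1 (a _) _]iterS [iter j.+1 D _]iterS.
  by rewrite -iter_commute// ih.
by exists (iter n.+1 (a n.+1) y); last exact: (yj n.+1).
Qed.

End Poles.

(** * Operators on complemented subspaces *)

Section ClosedSubspaces.
Variables (R : realType) (X : normedModType R[i]) (S : bounded_op X X).

Lemma submodN (M : submodClosed X) x : x \in M -> - x \in M.
Proof. by move=> xM; rewrite -scaleN1r rpredZ. Qed.

Lemma submodB (M : submodClosed X) x y : x \in M -> y \in M -> x - y \in M.
Proof. by move=> xM yM; rewrite rpredD ?submodN. Qed.

Lemma closed_val (M : submodClosed X) (A : set (subspace_of M)) :
  closed [set x | x \in M] -> closed A -> closed [set subspace_val x | x in A].
Proof.
move=> cM cA; apply/closed_nrm => x hx.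
have xM : x \in M.
  apply: ((closed_nrm _).1 cM) => e e0; have [_ [a Aa <-] xa] := hx _ e0.
  by exists (subspace_val a) => //=; exact: (valP a).
exists (SubspaceOf xM) => //; apply: ((closed_nrm _).1 cA) => e e0.
by have [_ [a Aa <-] xa] := hx _ e0; exists a.
Qed.

Lemma val_iter_restr (M : submodClosed X) (SM : Defs.invariant S M) n x :
  subspace_val (iter n (restr SM) x) = iter n S (subspace_val x).
Proof. by elim: n => //= n ->. Qed.

Lemma iter_invariant (M : submodClosed X) (SM : Defs.invariant S M) n x :
  x \in M -> iter n S x \in M.
Proof. by move=> xM; elim: n => //= n; exact: SM. Qed.

Lemma invariant_shift (M : submodClosed X) (w : R[i]^o) :
  Defs.invariant S M -> Defs.invariant (S - w *: bop_id X) M.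
Proof.
move=> SM x xM; suff : S x - w *: x \in M by [].
by rewrite submodB ?SM// rpredZ.
Qed.

Lemma direct_sumC (M N : submodClosed X) : direct_sum M N -> direct_sum N M.
Proof.
move=> [sumMN capMN]; split=> [x|x xN xM]; last exact: capMN.
have [m mM [n nN ->]] := sumMN x.
by exists n => //; exists m => //; rewrite addrC.
Qed.

End ClosedSubspaces.

(** * Open mapping on a closed subspace, perturbation of surjectivity, projections *)

Section Shifts.
Variables (R : realType) (X : completeNormedModType R[i]) (S : bounded_op X X).

(** The graph of [S] on [M] is a closed relation in [X]. The point [x'] replaces [x] by one of
    controlled norm in the same coset of the kernel. *)
Lemma restricted_open_mapping (M : submodClosed X) : closed [set x | x \in M] ->
  closed [set S x | x in [set x | x \in M]] ->
  exists2 C : R, 0 < C & forall x, x \in M ->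
    exists x', [/\ x' \in M, S x' = S x & nrm x' <= C * nrm (S x)].
Proof.
move=> cM cSM; pose G x y := x \in M /\ S x = y.
have [||||C C0 hC] := @closed_relation_open _ _ _ G.
- by split; [exact: rpred0|exact: bop_map0].
- move=> a x x' y y' [xM <-] [x'M <-]; split; first by rewrite rpredD ?rpredZ.
  by rewrite bop_mapD bop_mapZ.
- move=> x y h; split.
    apply: ((closed_nrm _).1 cM) => e e0; have [x' [y' [[x'M _] xx' _]]] := h _ e0.
    by exists x'.
  apply/eqP; rewrite -subr_eq0; apply/eqP; apply: nrm_small_eq0 => e e0.
  have S1 : 0 < nrm S + 1 by rewrite ltr_wpDl// nrm_ge0.
  have e2 : 0 < e / 2 by rewrite divr_gt0.
  have [|x' [_ [[_ <-] xx' yy']]] := h (Num.min (e / 2) (e / 2 / (nrm S + 1))).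
    by rewrite lt_min e2 divr_gt0.
  move: xx' yy'; rewrite !lt_min => /andP[_ xx'] /andP[yy' _].
  apply: le_lt_trans (nrm_triangle _ (S x') _) _; rewrite (splitr e).
  apply: ltrD; last by rewrite nrmBC.
  move: xx'; rewrite ltr_pdivlMr// => xx'; apply: le_lt_trans xx'.
  rewrite -bop_mapB (le_trans (bop_nrm_bound _ _))// mulrC ler_wpM2l ?nrm_ge0//.
  by rewrite lerDl.
- suff -> : [set y | exists x, G x y] = [set S x | x in [set x | x \in M]] by [].
  by apply/seteqP; split=> [y [x [xM <-]]|_ [x xM <-]]; exists x.
by exists C => // x xM; have [x' [x'M e] b] := hC x (S x) (conj xM erefl); exists x'.
Qed.

(** Let [g] be a right inverse of [S] on [M] with constant [C], not necessarily linear. The series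
    of the [w^k g^(k+1) y] converges for [nrm w < C^-1], and [S - w] maps its sum to [y] by
    telescoping. *)
Lemma surjective_perturbation (M : submodClosed X) : closed [set x | x \in M] ->
  Defs.invariant S M -> (forall y, y \in M -> exists2 x, x \in M & S x = y) ->
  exists2 d : R, 0 < d & forall w : R[i]^o, nrm w < d -> forall y, y \in M ->
    exists2 x, x \in M & (S - w *: bop_id X) x = y.
Proof.
move=> cM SM surj.
have SME : [set S x | x in [set x | x \in M]] = [set x | x \in M].
  apply/seteqP; split=> [_ [x /= xM <-]|y /= /surj[x xM <-]]; first exact: SM.
  by exists x.
have [|C C0 hC] := restricted_open_mapping cM; first by rewrite SME.
have lift y : exists x, y \in M -> [/\ x \in M, S x = y & nrm x <= C * nrm y].
  have [yM|yM] := boolP (y \in M); last by exists 0.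
  have [z zM <-] := surj _ yM; have [x h] := hC _ zM; by exists x.
have [g hg] := choice lift.
exists C^-1; rewrite ?invr_gt0// => w wC y yM.
pose x k := iter k.+1 g y.
have xM k : iter k g y \in M by elim: k => //= k /hg[].
have xE k : S (x k) = iter k g y by have [] := hg _ (xM k).
have xb k : nrm (x k) <= (C * nrm y) * C ^+ k.
  elim: k => [|k ih]; first by rewrite mulr1; have [] := hg _ yM.
  have [_ _ h] := hg _ (xM k.+1); apply: (le_trans h).
  by rewrite exprS mulrCA ler_wpM2l// ltW.
have q01 : 0 <= C * nrm w < 1.
  by rewrite mulr_ge0 ?nrm_ge0 ?(ltW C0)//= mulrC -ltr_pdivlMr// div1r.
have tb k : nrm (w ^+ k *: x k) <= (C * nrm y) * (C * nrm w) ^+ k.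
  rewrite nrmZ nrmX exprMn [C ^+ k * _]mulrC mulrCA ler_wpM2l ?exprn_ge0 ?nrm_ge0//.
have [l xl] : exists l : X, pseries x w @ \oo --> l.
  exact: nrm_cauchy_cvg (geometric_nrm_cauchy q01 tb).
exists l.
  apply: ((closed_nrm _).1 cM) => e e0; have [N hN] := (cvg_nrm _ _).1 xl _ e0.
  exists (pseries x w N); last exact: hN.
  by rewrite /= /pseries/series/= rpred_sum// => k _; rewrite rpredZ// (xM k.+1).
have h1 := pseries_map (L := S) xl; have h2 := pseries_shift xl.
have h3 := @pseries_delta _ _ w 0%N y; rewrite expr0 scale1r in h3.
have h4 := pseriesB h1 h2.
apply: cvg_nrm_unique h4 _; apply: seq_cvg_ext h3 => n; congr (pseries _ _ _).
by apply/funext => -[|k]; rewrite /= xE ?subr0// subrr.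
Qed.

(** The relation [m \in M], [x - m \in N] is closed and its range is [X], so the open mapping
    theorem yields some short [m']; the trivial intersection identifies it with [m]. *)
Lemma direct_sum_projection (M N : submodClosed X) : closed [set x | x \in M] ->
  closed [set x | x \in N] -> direct_sum M N ->
  exists2 C : R, 0 < C & forall m n, m \in M -> n \in N -> nrm m <= C * nrm (m + n).
Proof.
move=> cM cN [sumMN capMN]; pose G m x := m \in M /\ x - m \in N.
have [||||C C0 hC] := @closed_relation_open _ _ _ G.
- by split; rewrite ?subr0 rpred0.
- move=> a x x' y y' [xM yN] [x'M y'N]; split; first by rewrite rpredD ?rpredZ.
  by rewrite opprD addrACA -scalerBr rpredD ?rpredZ.
- move=> m x h; split.
    apply: ((closed_nrm _).1 cM) => e e0; have [m' [_ [[m'M _] mm' _]]] := h _ e0.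
    by exists m'.
  apply: ((closed_nrm _).1 cN) => e e0.
  have [|m' [x' [[_ xmN] mm' xx']]] := h (e / 2); first by rewrite divr_gt0.
  exists (x' - m') => //; rewrite opprD addrACA -opprD.
  by apply: le_lt_trans (nrmB _ _) _; rewrite (splitr e) ltrD.
- suff -> : [set x | exists m, G m x] = setT by exact: closedT.
  apply/seteqP; split=> // x _; have [m mM [n nN ->]] := sumMN x.
  by exists m; split; rewrite // addrAC subrr add0r.
exists C => // m n mM nN; have [|m' [m'M nN'] b] := hC m (m + n).
  by split; rewrite // addrAC subrr add0r.
suff e : m = m' by rewrite [in leLHS]e.
apply/eqP; rewrite -subr_eq0; apply/eqP; apply: capMN; first by rewrite submodB.
by have := submodB nN' nN; rewrite addrAC addrK.
Qed.

End Shifts.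

(** * Analytic family of eigenfunctionals *)

Section Eigenfunctionals.
Variables (R : realType) (X : completeNormedModType R[i]) (S : bounded_op X X).
Variables (M N : submodClosed X).
Hypotheses (cM : closed [set x | x \in M]) (cN : closed [set x | x \in N]).
Hypothesis MN : direct_sum M N.
Hypotheses (SM : Defs.invariant S M) (SN : Defs.invariant S N).
Hypothesis cSM : closed [set S x | x in [set x | x \in M]].
Hypothesis kerS : forall x, x \in M -> S x = 0 ->
  forall n, exists2 u, u \in M & iter n S u = x.

(* The functional [phi_0] kills [S M + N]; then [phi_(k+1)] is defined on
   [S M + N] by [phi_(k+1) (S m + n) = phi_k m], which makes sense because
   [phi_k] kills [N(S) \cap M], and extended by Hahn-Banach. The eigenfunctional
   for [w] is [sum_k w^k phi_k]. *)
Lemma analytic_eigenfunctionals y0 : y0 \in M -> (forall x, x \in M -> S x <> y0) ->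
  exists (f : R[i]^o -> dual X) (d : R), [/\ 0 < d,
    analytic_on f (ball (0 : R[i]^o) d%:C),
    forall w : R[i]^o, nrm w < d -> forall x, f w (S x) = w * f w x &
    forall w : R[i]^o, nrm w < d -> f w <> 0].
Proof.
move=> y0M ny0; have [cP cP0 hP] := direct_sum_projection cM cN MN.
have [cO cO0 hO] := restricted_open_mapping cM cSM.
(* Passing from [phi k] to [phi k.+1] costs [cO] for a short preimage of [S m] in [M], and [cP] for
   bounding [S m] by [S m + n]. *)
pose c := cP * cO; have c0 : 0 < c by rewrite mulr_gt0.
have [dl dl0 hdl] : exists2 dl : R, 0 < dl & forall u, u \in M -> dl <= nrm (y0 + S u).
  apply: contrapT => nd; have [u uM Su] : [set S x | x in [set x | x \in M]] y0.
    apply: ((closed_nrm _).1 cSM) => e e0; apply: contrapT => ne; apply: nd.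
    exists e => // u uM; rewrite leNgt; apply/negP => h; apply: ne.
    exists (S (- u)); first by exists (- u) => //=; rewrite submodN.
    by rewrite -[S (- u)]/(S (- u)) raddfN opprK.
  exact: ny0 uM Su.
(* [phi0] takes the value [l] at [l *: y0 + S u + n]: [cP] removes [n], and [dl] is a lower bound
   for the distance from [y0] to the closed subspace [S M]. *)
pose K0 := cP / dl; have K00 : 0 <= K0 by rewrite divr_ge0 ?ltW.
have [|||phi0 phi0K phi0E] := @complex_hahn_banach _ X _ K00
    (fun x (l : R[i]^o) => exists u n, [/\ u \in M, n \in N & x = l *: y0 + S u + n]).
- by exists 0, 0; rewrite !rpred0 scale0r bop_map0 !addr0.
- move=> a _ _ l m [u [n [uM nN ->]]] [u' [n' [u'M n'N ->]]].
  exists (a *: u + u'), (a *: n + n'); split; rewrite ?rpredD ?rpredZ//.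
  rewrite bop_mapD bop_mapZ !scalerDr scalerA scalerDl addrACA; congr (_ + _).
  by rewrite addrACA.
- move=> _ l [u [n [uM nN ->]]]; have [->|l0] := eqVneq l 0.
    by rewrite nrm0 mulr_ge0 ?nrm_ge0.
  have lM : l *: y0 + S u \in M by rewrite rpredD ?rpredZ// SM.
  rewrite /K0 mulrAC ler_pdivlMr//; apply: le_trans (hP _ _ lM nN).
  have -> : l *: y0 + S u = l *: (y0 + S (l^-1 *: u)).
    by rewrite bop_mapZ scalerDr scalerA mulfV// scale1r.
  by rewrite nrmZ ler_wpM2l ?nrm_ge0// hdl// rpredZ.
(* Vanishing on [S^(k+1) M] is the invariant behind the next extension: by [kerS] the kernel of [S]
   in [M] lies in [S^(k+1) M], so [phi] kills it. *)
pose good k (phi : dual X) := [/\ nrm phi <= K0 * c ^+ k,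
  forall n, n \in N -> phi n = 0 & forall m, m \in M -> phi (iter k.+1 S m) = 0].
have good0 : good 0%N phi0.
  split; first by rewrite mulr1.
  - by move=> n nN; apply: phi0E; exists 0, n; rewrite rpred0 scale0r bop_map0 !add0r.
  - by move=> m mM; apply: phi0E; exists m, 0; rewrite rpred0 scale0r addr0 add0r.
have step (kp : nat * dual X) : exists psi : dual X, good kp.1 kp.2 ->
    good kp.1.+1 psi /\ forall x, psi (S x) = kp.2 x.
  case: kp => k phi /=; have [[phiK phiN phiM]|ng] := pselect (good k phi); last first.
    by exists 0.
  have K1 : 0 <= K0 * c ^+ k.+1 by rewrite mulr_ge0// exprn_ge0// ltW.
  have [|||psi psiK psiE] := @complex_hahn_banach _ X _ K1
      (fun x b => exists m n, [/\ m \in M, n \in N, x = S m + n & b = phi m]).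
  - by exists 0, 0; rewrite !rpred0 !bop_map0 addr0.
  - move=> a _ _ _ _ [m [n [mM nN -> ->]]] [m' [n' [m'M n'N -> ->]]].
    exists (a *: m + m'), (a *: n + n'); split; rewrite ?rpredD ?rpredZ//.
      by rewrite bop_mapD bop_mapZ scalerDr addrACA.
    by rewrite bop_mapD bop_mapZ.
  - move=> _ _ [m [n [mM nN -> ->]]]; have [m' [m'M Sm' bm']] := hO _ mM.
    have -> : phi m = phi m'.
      apply/eqP; rewrite -subr_eq0 -bop_mapB; apply/eqP.
      have Smm' : S (m - m') = 0 by rewrite bop_mapB Sm' subrr.
      have [u uM <-] := kerS (submodB mM m'M) Smm' k.+1.
      exact: phiM.
    apply: le_trans (bop_nrm_bound _ _) _.
    apply: (@le_trans _ _ (K0 * c ^+ k * (cO * nrm (S m)))).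
      by apply: ler_pM; rewrite ?nrm_ge0.
    rewrite exprSr [K0 * (_ * c)]mulrA -[leRHS]mulrA.
    rewrite ler_wpM2l ?(mulr_ge0 K00) ?exprn_ge0 ?(ltW c0)//.
    rewrite /c mulrAC [leRHS]mulrC ler_wpM2l ?(ltW cO0)//.
    by apply: hP => //; exact: SM.
  exists psi => _; have psiS x : psi (S x) = phi x.
    have [m mM [n nN ->]] := MN.1 x; apply: psiE; exists m, (S n).
    by split; rewrite ?SN// ?bop_mapD ?(phiN n)// addr0.
  split=> //; split=> //.
  - move=> n nN; apply: psiE; exists 0, n.
    by rewrite rpred0 !bop_map0 add0r.
  - by move=> m mM; rewrite [iter k.+2 S m]iterS psiS phiM.
have [g hg] := choice step.
pose phi := fix phi k : dual X := if k is j.+1 then g (j, phi j) else phi0.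
have phi_good k : good k (phi k).
  by elim: k => [|k ih] //; have [] := hg (k, phi k) ih.
have phiS k x : phi k.+1 (S x) = phi k x.
  by have [_ h] := hg (k, phi k) (phi_good k); exact: h.
have phi0S x : phi 0%N (S x) = 0.
  have [_ hN hM] := good0; have [m mM [n nN ->]] := MN.1 x.
  by rewrite /= !bop_mapD (hN _ (SN nN)) addr0; exact: (hM m mM).
have phiK k : nrm (phi k) <= K0 * c ^+ k by have [] := phi_good k.
have /choice[f hf] : forall w : R[i]^o, exists l : dual X,
    nrm w < c^-1 -> pseries phi w @ \oo --> l.
  move=> w; have [wc|nwc] := pselect (nrm w < c^-1); last by exists 0.
  have q01 : 0 <= c * nrm w < 1.
    by rewrite mulr_ge0 ?nrm_ge0 ?(ltW c0)//= mulrC -ltr_pdivlMr// div1r.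
  have tb k : nrm (w ^+ k *: phi k) <= K0 * (c * nrm w) ^+ k.
    rewrite nrmZ nrmX exprMn [c ^+ k * _]mulrC mulrCA.
    exact: ler_wpM2l (exprn_ge0 _ (nrm_ge0 _)) _ _ (phiK k).
  have [l hl] := @dual_complete _ X _ (geometric_nrm_cauchy q01 tb).
  by exists l.
have ic0 : 0 < c^-1 by rewrite invr_gt0.
have fan := pseries_analytic (@dual_complete _ X) c0 phiK hf.
(* At [y0] the functional [f 0] takes the value of [phi0], which is 1; continuity at 0 then keeps
   [f w] nonzero on a smaller disc. *)
have f0 : 0 < nrm (f 0).
  apply: nrm_gt0; apply/eqP => f00.
  have h : pseries phi (0 : R[i]^o) @ \oo --> f 0 by apply: hf; rewrite nrm0.
  have := pseries_eval (x := y0) h.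
  have := @pseries_delta R R[i]^o 0 0%N (phi0 y0).
  rewrite expr0 scale1r => h1 h2; have := cvg_nrm_unique (l1 := phi0 y0) (l2 := f 0 y0) _ h2.
  rewrite f00 => h3; have : phi0 y0 = 0.
    apply: h3; apply: seq_cvg_ext h1 => n; apply: eq_bigr => -[|k] _ //.
    by rewrite expr0n !scale0r.
  rewrite (phi0E y0 1); last by exists 0, 0; rewrite !rpred0 bop_map0 !addr0 scale1r.
  by move/eqP; rewrite oner_eq0.
have [d1 d10 hd1] := pseries_continuous ic0 hf f0.
exists f, (Num.min d1 c^-1); split.
- by rewrite lt_min d10 ic0.
- apply/analytic_onP => z; rewrite lt_min => /andP[_ zc].
  exact: ((analytic_onP _ _ _).1 fan).
- move=> w; rewrite lt_min => /andP[_ wc] x; have h := hf _ wc.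
  have h1 := pseries_eval (x := S x) h.
  have h2 := pseries_shift (pseries_eval (x := x) h).
  apply: cvg_nrm_unique h1 _; apply: seq_cvg_ext h2 => n; congr (pseries _ _ _).
  by apply/funext => -[|k]; rewrite ?phi0S ?phiS.
- move=> w; rewrite lt_min => /andP[wd _] fw; have := hd1 _ wd.
  by rewrite fw sub0r nrmN ltxx.
Qed.

End Eigenfunctionals.

(** * Descent and lower semi-B-Browder operators *)

Section Descent.
Variables (R : realType) (X : normedModType R[i]) (D : bounded_op X X).

(** [D^p] maps [R(D^n)] onto [R(D^(p+n))], so descent at most [p] for the restriction gives descent
    at most [p + n] for [D]. *)
Lemma lower_semi_B_Browder_descent : lower_semi_B_Browder D ->
  exists n, forall x, exists y, iter n D x = iter n.+1 D y.
Proof.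
move=> [n [_ [_ [p hp]]]]; exists (p + n)%N => x.
have xn : iter n D x \in range_pow D n by apply/range_powP; exists x.
have : range (iter p (restr_range_pow D n)) (iter p (restr_range_pow D n) (SubspaceOf xn)).
  by exists (SubspaceOf xn).
rewrite hp => -[u _ /(congr1 (@subspace_val _ _ _))].
rewrite !val_iter_restr/= => h; have /range_powP[y yE] := valP u.
by exists y; rewrite /= !iterD -h yE.
Qed.

(** [D] maps [R(D^n)] onto itself, so the restriction has range of codimension 0 and descent 0. *)
Lemma lower_semi_B_Browder_of_descent n : closed (range (iter n D)) ->
  (forall x, exists y, iter n D x = iter n.+1 D y) -> lower_semi_B_Browder D.
Proof.
move=> cD hD; exists n; split => //.
have surj y : exists x, restr_range_pow D n x = y.
  case: y => y yn; have /range_powP[x xy] := yn; have [z xz] := hD x.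
  have zn : iter n D z \in range_pow D n by apply/range_powP; exists z.
  by exists (SubspaceOf zn); apply: val_inj => /=; rewrite -xy xz.
split.
  exists 0%N, (fun=> 0) => x; exists (fun=> 0); rewrite big_ord0 subr0.
  by have [y <-] := surj x; exists y.
exists 0%N; apply/seteqP; split => // y _.
by have [x <-] := surj y; exists x.
Qed.

Lemma iter_opp (D' : bounded_op X X) n x : (forall y, D' y = - D y) ->
  iter n D' x = iter n D ((-1) ^+ n *: x).
Proof.
move=> D'E; elim: n x => [|n ih] x; first by rewrite expr0 scale1r.
by rewrite iterSr ih D'E [RHS]iterSr bop_mapZ exprSr -scalerA scaleN1r.
Qed.

(** Transfers the result for [S - w], which is studied on [M] and [N], to its opposite [T - z]. *)
Lemma lower_semi_B_Browder_opp (D' : bounded_op X X) n : (forall y, D' y = - D y) ->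
  closed (range (iter n D)) ->
  (forall x, exists y, iter n D x = iter n.+1 D y) ->
  closed (range (iter n D')) /\ forall x, exists y, iter n D' x = iter n.+1 D' y.
Proof.
move=> D'E cD hD.
have sgn k x : x = (-1) ^+ k *: ((-1) ^+ k *: x).
  by rewrite scalerA -expr2 sqrr_sign scale1r.
have iterE k x : iter k D x = iter k D' ((-1) ^+ k *: x).
  by rewrite (iter_opp _ _ D'E) -sgn.
split.
  suff -> : range (iter n D') = range (iter n D) by [].
  apply/seteqP; split=> _ [x _ <-].
    by exists ((-1) ^+ n *: x); rewrite ?(iter_opp _ _ D'E).
  by exists ((-1) ^+ n *: x); rewrite ?iterE.
move=> x; have [y xy] := hD ((-1) ^+ n *: x).
by exists ((-1) ^+ n.+1 *: y); rewrite -iterE -xy (iter_opp _ _ D'E).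
Qed.

End Descent.

(* If [D^n x = D^(n+1) y] with [D = w - S], applying [f (w + t)] gives
   [f (w + t) x = - t * f (w + t) y]; let [t] tend to [0]. *)
Lemma eigenfunctional_finite_descent (R : realType) (X : normedModType R[i])
    (S D : bounded_op X X) (f : R[i]^o -> dual X) (d : R) (w : R[i]^o) n :
  analytic_on f (ball (0 : R[i]^o) d%:C) ->
  (forall v : R[i]^o, nrm v < d -> forall x, f v (S x) = v * f v x) ->
  nrm w < d -> (forall x, D x = w *: x - S x) ->
  (forall x, exists y, iter n D x = iter n.+1 D y) -> f w = 0.
Proof.
move=> fan feig wd DE hD; apply: bop_ext => x; have [y xy] := hD x.
have [a [s [s0 hs]]] : exists a (s : R), 0 < s /\
    forall t, nrm t < s -> pseries a t @ \oo --> f (w + t).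
  by apply: ((analytic_onP _ _ _).1 fan); rewrite subr0.
have fD t k u : nrm (w + t) < d -> f (w + t) (iter k D u) = (- t) ^+ k * f (w + t) u.
  move=> wt; elim: k => [|k ih]; first by rewrite mul1r.
  rewrite iterS DE bop_mapB bop_mapZ feig// -[_ *: _]/(_ * _) ih exprS.
  by ring.
(* The limit is taken on coefficients: [f (w + t) x + t * f (w + t) y] vanishes for small [t != 0],
   hence so does its coefficient of degree 0, which is [f w x]. *)
have coef k : a k x - (if k is j.+1 then a j (- y) else 0) = 0.
  move: k; apply: (@pseries_unique _ _ _ (fun t => f (w + t) x - t *: f (w + t) (- y)) s s0).
    move=> t ts; have h := hs _ ts.
    exact: pseriesB (pseries_eval (x := x) h) (pseries_shift (pseries_eval (x := - y) h)).
  move=> e e0; pose m := Num.min e (d - nrm w).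
  have m0 : 0 < m by rewrite lt_min e0 subr_gt0.
  have [me md] : m <= e /\ m <= d - nrm w by rewrite /m !ge_min !lexx orbT.
  pose t : R[i]^o := (m / 2)%:C; have nt : nrm t = m / 2.
    by rewrite nrm_real gtr0_norm// divr_gt0.
  have t0 : t != 0 by apply/eqP => t0; move: nt; rewrite t0 nrm0; lra.
  exists t; split => //; first by rewrite nt; lra.
  have wt : nrm (w + t) < d by apply: le_lt_trans (nrmD _ _) _; rewrite nt; lra.
  have := congr1 (f (w + t)) xy; rewrite !fD// exprSr -mulrA.
  have nt0 : (- t) ^+ n != 0 by rewrite expf_eq0 negb_and oppr_eq0 t0 orbT.
  move=> /(mulfI nt0) ->; rewrite bop_mapN.
  by rewrite -[t *: _]/(t * _) mulNr mulrN opprK addNr.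
have fw : f w x = a 0%N x.
  have h := hs 0; rewrite nrm0 addr0 in h; have h1 := pseries_eval (x := x) (h s0).
  apply: (cvg_nrm_unique h1); apply: (@seq_cvg_near _ _ _ _ 1) => -[//|k _].
  elim: k => [|k ih]; first by rewrite pseriesS pseries0 expr0 scale1r add0r.
  by rewrite pseriesS ih expr0n scale0r addr0.
by rewrite fw; have := coef 0%N; rewrite subr0.
Qed.

(** * Equivalence of the three statements *)

Theorem corollary2p2 (R : realType) (X : completeNormedModType R[i])
    (hX : infinite_dimensional X) (T : bounded_op X X) (l0 : R[i]^o)
    (hT : generalized_Kato_meromorphic (l0 *: bop_id X - T)) :
  (svep_at (adjoint T) l0 <-> ~ interior (surjective_spectrum T) l0) /\
  (~ interior (surjective_spectrum T) l0 <->
     ~ limit_point (lower_semi_B_Browder_spectrum T) l0).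
Proof.
move: hT; set S := l0 *: bop_id X - T => -[M [N [SM [SN [cM cN MN [cK kerK] mero]]]]].
have cSM : closed [set S x | x in [set x | x \in M]].
  suff <- : [set subspace_val x | x in range (restr SM)] = [set S x | x in [set x | x \in M]].
    exact: closed_val.
  apply/seteqP; split=> [_ [_ [x _ <-] <-]|_ [x xM <-]].
    by exists (subspace_val x) => //=; exact: (valP x).
  by exists (restr SM (SubspaceOf xM)) => //; exists (SubspaceOf xM).
have kerS x : x \in M -> S x = 0 -> forall n, exists2 u, u \in M & iter n S u = x.
  move=> xM Sx n; have : restr SM (SubspaceOf xM) = 0 by apply: val_inj.
  move=> /(kerK n)[u _ /(congr1 (@subspace_val _ _ _))]; rewrite val_iter_restr => h.
  by exists (subspace_val u) => //; exact: (valP u).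
have shiftE (z : R[i]^o) x : (T - z *: bop_id X) x = (l0 - z) *: x - S x.
  by rewrite -[LHS]/(T x - z *: x) -[S x]/(l0 *: x - T x) scalerBl
    [- (_ - T x)]opprB [RHS]addrC addrA subrK.
have [surjM|nsurjM] := pselect (forall y, y \in M -> exists2 x, x \in M & S x = y).
- have [d d0 hd] := surjective_perturbation cM SM surjM.
  (* Either [e / 2] is off the spectrum, or it is isolated in it and a point at distance at most
     [e / 4] to its right is off. *)
  have sparse (e : R) : 0 < e -> exists w : R[i]^o,
      [/\ w != 0, nrm w < e & ~ spectrum (restr SN) w].
    move=> e0; have e20 : 0 < e / 2 by rewrite divr_gt0.
    pose w0 : R[i]^o := (e / 2)%:C.
    have real_neq0 (t : R) : 0 < t -> (t%:C : R[i]^o) != 0.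
      by move=> t0; rewrite -[0]/(0%:C) (inj_eq (@complexI R)) gt_eqF.
    have [sp|nsp] := pselect (spectrum (restr SN) w0); last first.
      by exists w0; split; rewrite ?real_neq0// nrm_real gtr0_norm//; lra.
    have [/not_limit_point_nrm[r r0 hr] _] := mero _ sp (real_neq0 _ e20).
    pose m := Num.min r (e / 2).
    have m0 : 0 < m by rewrite lt_min r0 e20.
    have [mr me] : m <= r /\ m <= e / 2 by rewrite /m !ge_min !lexx orbT.
    have wE : ((e / 2 + m / 2)%:C : R[i]^o) - w0 = (m / 2)%:C.
      by rewrite /w0 -rmorphB addrAC subrr add0r.
    have m20 : 0 < m / 2 by rewrite divr_gt0.
    exists (e / 2 + m / 2)%:C; split; first by rewrite real_neq0// addr_gt0.
      by rewrite nrm_real gtr0_norm; lra.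
    apply: hr; first by rewrite -subr_eq0 wE real_neq0.
    by rewrite wE nrm_real gtr0_norm//; lra.
  have surj_shift (w : R[i]^o) : nrm w < d -> ~ spectrum (restr SN) w ->
      forall y, exists x, (T - (l0 - w) *: bop_id X) x = y.
    (* The opposite of [y] is split because [T - (l0 - w) = -(S - w)]. *)
    move=> wd /contrapT[A [_ inv]] y; have [m mM [n nN mn]] := MN.1 (- y).
    have [x xM xm] := hd _ wd _ mM.
    have [x' xn] : exists x', S x' - w *: x' = n.
      exists (subspace_val (A (SubspaceOf nN))).
      exact: (congr1 (fun h : bounded_op _ _ => subspace_val (h (SubspaceOf nN))) inv).
    exists (x + x'); rewrite shiftE subKr.
    rewrite -[y]opprK mn -xn -xm -[(S - _) x]/(S x - w *: x) bop_mapD scalerDr.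
    by rewrite [in RHS]addrACA -opprD opprB.
  have shiftN w : nrm (l0 - w - l0 : R[i]^o) = nrm w.
    by rewrite addrAC subrr add0r nrmN.
  have not_interior : ~ interior (surjective_spectrum T) l0.
    move=> /nbhs_nrm[r r0 hr]; have [|w [w0]] := sparse (Num.min d r).
      by rewrite lt_min d0.
    rewrite lt_min => /andP[wd wr] nsp; apply: (hr (l0 - w)); first by rewrite shiftN.
    exact: surj_shift.
  split; split => // _.
    move=> _ /complex_gt0[e e0 ->] f fan feq z /ball_nrm ze.
    (* Where [T - z] is onto, [adjoint T - z] is injective and [f z = 0]; such points accumulate at
       [l0]. *)
    apply: (analytic_identity fan e0 _ ze) => r r0.
    have [|w [w0]] := sparse (Num.min d (Num.min r e)); first by rewrite !lt_min d0 r0.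
    rewrite !lt_min => /and3P[wd wr we] nsp; exists (l0 - w); split.
    - by rewrite -subr_eq0 addrAC subrr add0r oppr_eq0.
    - by rewrite shiftN.
    - apply: bop_ext => y; have [x <-] := surj_shift _ wd nsp y.
      have wball : ball l0 e%:C (l0 - w) by apply/ball_nrm; rewrite shiftN.
      have := congr1 (fun h : dual X => h x) (feq _ wball).
      by rewrite -[(T - _) x]/(T x - (l0 - w) *: x) bop_mapB bop_mapZ.
  move=> /(_ [set z : R[i]^o | nrm (z - l0) < d]) [|z [zl0 + zd]].
    by apply/nbhs_nrm; exists d.
  apply; pose w : R[i]^o := l0 - z.
  have wd : nrm w < d by rewrite /w nrmBC.
  have w0 : w != 0 by rewrite subr_eq0 eq_sym.
  (* At a spectral point of [S|N] the exponent comes from the pole; elsewhere 0 works, since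
     [S|N - w] is onto. *)
  have [n [cDN hDN]] : exists n, closed (range (iter n (restr SN - w *: bop_id _))) /\
      forall x, exists y, iter n (restr SN - w *: bop_id _) x =
        iter n.+1 (restr SN - w *: bop_id _) y.
    have [sp|/contrapT[A [_ inv]]] := pselect (spectrum (restr SN) w).
      by have [nlim pl] := mero _ sp w0; exact: pole_range.
    exists 0%N; split=> [|x]; first by rewrite image_id; exact: closedT.
    exists (A x); have := congr1 (fun h : bounded_op _ _ => h x) inv.
    by move=> /esym.
  pose D := S - w *: bop_id X.
  have iterN u : subspace_val (iter n (restr SN - w *: bop_id _) u) = iter n D (subspace_val u).
    by elim: n {cDN hDN} => //= n ->.
  have iterN1 u : subspace_val (iter n.+1 (restr SN - w *: bop_id _) u) =
      iter n.+1 D (subspace_val u) by rewrite /= -iterN.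
  have DM k m : m \in M -> exists2 m', m' \in M & iter k D m' = m.
    elim: k m => [|k ih] m mM; first by exists m.
    by have [x /ih[x' x'M <-] <-] := hd _ wd _ mM; exists x'.
  have [|||cD hD] := @lower_semi_B_Browder_opp _ _ D (T - z *: bop_id X) n.
  - by move=> y; rewrite shiftE -[RHS]/(- (S y - w *: y)) [RHS]opprB.
  (* Since [D] maps [M] onto [M], the range of [D^n] is [M + D^n N]. By boundedness of the
     projection onto [N], the [N]-component of a limit point is a limit of points of the closed set
     [D^n N]. *)
  - have [C C0 hC] := direct_sum_projection cN cM (direct_sumC MN).
    have cKD := closed_val cN cDN.
    apply/closed_nrm => x hx; have [m mM [k kN xE]] := MN.1 x.
    have [_ [u _ <-] uk] : [set subspace_val u | u in range (iter n (restr SN - w *: bop_id _))] k.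
      apply: ((closed_nrm _).1 cKD) => e e0.
      have [_ [y _ <-] xy] := hx _ (divr_gt0 e0 C0).
      have [m1 m1M [n1 n1N yE]] := MN.1 y.
      exists (iter n D n1).
        exists (iter n (restr SN - w *: bop_id _) (SubspaceOf n1N)); last by rewrite iterN.
        by exists (SubspaceOf n1N).
      move: xy; rewrite ltr_pdivlMr// mulrC; apply: le_lt_trans.
      have -> : x - iter n D y = (k - iter n D n1) + (m - iter n D m1).
        by rewrite xE yE iter_bopD opprD addrACA addrC.
      apply: hC; apply: submodB => //; apply: iter_invariant => //.
        exact: invariant_shift.
      exact: invariant_shift.
    have [m' m'M mE] := DM n m mM.
    by exists (m' + subspace_val u) => //; rewrite iter_bopD mE -iterN uk.
  - move=> x; have [m mM [k kN ->]] := MN.1 x.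
    have [m' m'M mE] := DM 1%N m mM; have [u uE] := hDN (SubspaceOf kN).
    exists (m' + subspace_val u); rewrite !iter_bopD -iterN1 -uE iterN.
    by rewrite iterSr; congr (_ + _); rewrite -mE.
  exact: lower_semi_B_Browder_of_descent cD hD.
- have [y0 y0M ny0] : exists2 y0, y0 \in M & forall x, x \in M -> S x <> y0.
    apply: contrapT => nex; apply: nsurjM => y yM; apply: contrapT => ny.
    by apply: nex; exists y => // x xM Sx; apply: ny; exists x.
  have [f [d [d0 fan feig fneq]]] :=
    analytic_eigenfunctionals cM cN MN SM SN cSM kerS y0M ny0.
  have inter : interior (surjective_spectrum T) l0.
    apply/nbhs_nrm; exists d => // z zd surj.
    have wd : nrm (l0 - z : R[i]^o) < d by rewrite nrmBC.
    apply: (fneq _ wd); apply: bop_ext => y; have [x <-] := surj y.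
    by rewrite shiftE bop_mapB bop_mapZ feig// subrr.
  have limit : limit_point (lower_semi_B_Browder_spectrum T) l0.
    move=> U /nbhs_nrm[r r0 rU]; pose m := Num.min d r.
    have m0 : 0 < m by rewrite lt_min d0.
    have [md mr] : m <= d /\ m <= r by rewrite /m !ge_min !lexx orbT.
    pose t : R[i]^o := (m / 2)%:C.
    have nt : nrm t = m / 2 by rewrite nrm_real gtr0_norm// divr_gt0.
    have tE : l0 + t - l0 = t by rewrite addrAC subrr add0r.
    exists (l0 + t); split.
    + rewrite -subr_eq0 tE; apply/eqP => t0; move: nt; rewrite t0 nrm0; lra.
    + move=> /lower_semi_B_Browder_descent[n hn].
      have wd : nrm (l0 - (l0 + t) : R[i]^o) < d by rewrite nrmBC tE nt; lra.
      exact: (fneq _ wd (eigenfunctional_finite_descent fan feig wd (shiftE _) hn)).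
    + by apply: rU; rewrite tE nt; lra.
  have not_svep : ~ svep_at (adjoint T) l0.
    move=> svep; have nd : nrm (l0 - l0 : R[i]^o) < d by rewrite subrr nrm0.
    apply: (fneq _ nd); have d0' : 0 < d%:C by rewrite ltcR.
    (* An eigenfunctional of [S] for [w] is one of [T = l0 - S] for [z = l0 - w]. *)
    apply: (svep _ d0' (fun z => f (l0 - z))).
    + apply/analytic_onP => z zd; have wd : nrm (l0 - z : R[i]^o) < d by rewrite nrmBC.
      have [a [r [r0 h]]] : exists a (r : R), 0 < r /\
          forall t, nrm t < r -> pseries a t @ \oo --> f (l0 - z + t).
        by apply: ((analytic_onP _ _ _).1 fan); rewrite subr0.
      (* The signs come from [l0 - (z + t) = (l0 - z) - t]. *)
      exists (fun k => (-1) ^+ k *: a k), r; split => // t tr.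
      have := h (- t); rewrite nrmN opprD addrA => /(_ tr); apply: seq_cvg_ext => n.
      by apply: eq_bigr => k _; rewrite scalerA -exprMn mulrN1.
    + move=> z /ball_nrm zd; apply: bop_ext => x.
      have wd : nrm (l0 - z : R[i]^o) < d by rewrite nrmBC.
      suff : f (l0 - z) ((T - z *: bop_id X) x) = 0.
        by rewrite -[(T - _) x]/(T x - z *: x) bop_mapB bop_mapZ.
      by rewrite shiftE bop_mapB bop_mapZ feig// subrr.
    + by apply/ball_nrm; rewrite subrr nrm0.
  by split; split.
Qed.
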